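(* Let $1<p<\infty$ and $w\in A_p$. Set $\sigma=w^{1-p'}$ and $\varepsilon=\dfrac{p-1}{C[\sigma]_{A_\infty}}$ with $C=4D^{10}$, where $D$ is the doubling constant. Then $w\in A_{p-\varepsilon}$ and $$[w]_{A_{p-\varepsilon}}\le 2^{p-1}D^{4p-2}[w]_{A_p}.$$
   Context: $G$ is a locally compact abelian group (written additively) with a measure $\mu$ that is inner regular and satisfies $\mu(K)<\infty$ for every compact $K\subset G$ ($\mu$ is not assumed translation invariant). A covering family for $G$ is a collection $\{U_i\}_{i\in\mathbb{Z}}$ such that: (1) $\{U_i\}_{i\in\mathbb{Z}}$ is an increasing base of relatively compact neighborhoods of $0$, $\bigcup_{i\in\mathbb{Z}}U_i=G$ and $\bigcap_{i}U_i=\{0\}$; (2) there are a constant $D\ge 1$ (the doubling constant) and an increasing function $\theta:\mathbb{Z}\to\mathbb{Z}$ such that for all $i\in\mathbb{Z}$ and $x\in G$: $i\le\theta(i)$, $U_i-U_i\subset U_{\theta(i)}$, and $\mu(x+U_{\theta(i)})\le D\,\mu(x+U_i)$. A covering family for $G$ is fixed, with $D$ and $\theta$ as in (2), and the sets $U_i$ are assumed symmetric ($U_i=-U_i$). Base sets are the elements of $\mathcal{B}:=\{x+U_i: x\in G, i\in\mathbb{Z}\}$. The maximal function is $Mf(x)=\sup_{x\in U\in\mathcal{B}}\frac1{\mu(U)}\int_U|f|\,d\mu$. A weight is a nonnegative locally integrable function on $G$. For $1<p<\infty$, with $\frac1p+\frac1{p'}=1$, a weight $w$ is in $A_p$ if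 $$[w]_{A_p}:=\sup_{U\in\mathcal{B}}\left(\frac1{\mu(U)}\int_U w\,d\mu\right)\left(\frac1{\mu(U)}\int_U w^{1-p'}\,d\mu\right)^{p-1}<\infty.$$ The $A_\infty$ constant of a weight $w$ is $$[w]_{A_\infty}:=\sup_{U\in\mathcal{B}}\frac1{w(U)}\int_U M(w\chi_U)\,d\mu,\qquad w(U)=\int_U w\,d\mu.$$
   Formalization: The formal theorem assumes i < θ(i) for all i instead of i ≤ θ(i); with only i ≤ θ(i) the claim is false (G = Z/2, U_i = {0} or G, θ = id, D = 1, p = 2, μ{0} = t → 0, μ{1} = 1, w = (t,1)). *)

(* Defs.v *)
From HB Require Import structures.
From mathcomp Require Import all_boot all_order all_algebra.
From mathcomp Require Import all_classical all_reals all_analysis.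
From mathcomp Require Import measurable_realfun.

Set Implicit Arguments.
Unset Strict Implicit.
Unset Printing Implicit Defensive.

Import Order.TTheory GRing.Theory Num.Theory.
Import numFieldNormedType.Exports.

Local Open Scope classical_set_scope.
Local Open Scope ring_scope.
Local Open Scope ereal_scope.

(* [G], pointed at 0, with its Borel sigma-algebra. *)
Definition borel (G : topologicalZmodType) : Type := G.

Section borel_instances.
Variable G : topologicalZmodType.

HB.instance Definition _ := Choice.copy (borel G) G.
HB.instance Definition _ := isPointed.Build (borel G) (0%R : G).
HB.instance Definition _ := @isMeasurable.Build (sigma_display (@open G))
  (borel G) <<s @open G >>
  (@sigma_algebra0 (borel G) setT (@open G))
  (@sigma_algebraC (borel G) (@open G))
  (@sigma_algebra_bigcup (borel G) setT (@open G)).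

End borel_instances.

Section covering_families.
Context {R : realType} {G : topologicalZmodType}.
Variable mu : {measure set (borel G) -> \bar R}.

Definition inner_regular : Prop := forall A : set (borel G), measurable A ->
  mu A = ereal_sup [set mu K | K in [set K : set G | compact K /\ K `<=` A]].

Definition finite_on_compacts : Prop :=
  forall K : set G, compact K -> mu K < +oo.

Definition translate (x : G) (A : set G) : set G := [set (x + y)%R | y in A].

(* The sets [U i] are required to be Borel, which the mere use of
   [mu (x + U i)] presupposes: a neighborhood need not be open.

   [cf_theta_ge] alone does not make [mu] doubling. If the [U i] are subgroups,
   then [theta = id] and [D = 1] satisfy [cf_sub] and [cf_doubling] for every
   [mu], and the open property of A_p weights fails: take G = Z/2,
   U i = {0} for i <= 0, U i = G for i > 0, p = 2, mu{0} = t, mu{1} = 1,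
   sigma(0) = 1/t, sigma(1) = 1, w = 1/sigma. Then D^(4p-2) = 1, and as t -> 0,
   [w]_{A_2} -> 2 and [sigma]_{A_oo} -> 3/2, hence eps -> 1/6, whereas
   [w]_{A_(2-eps)} >= (w(G)/mu(G)) (t^(1-r)/mu(G))^(1/r), where
   r = 1/(1-eps) -> 6/5, is unbounded. Theorems about covering families which
   rely on doubling therefore assume [i < theta i] for all [i]. *)
Record covering_family (U : int -> set G) (D : R) (theta : int -> int) : Prop :=
  { cf_nbhs : forall i, nbhs (0%R : G) (U i)
  ; cf_borel : forall i, measurable (U i : set (borel G))
  ; cf_precompact : forall i, precompact (U i)
  ; cf_increasing : forall i j : int, (i <= j)%R -> U i `<=` U j
  ; cf_base : forall V : set G, nbhs (0%R : G) V -> exists i, U i `<=` V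
  ; cf_cover : \bigcup_i U i = [set: G]
  ; cf_separated : \bigcap_i U i = [set 0%R]
  ; cf_doubling_ge1 : (1 <= D)%R
  ; cf_theta_increasing : forall i j : int, (i <= j)%R -> (theta i <= theta j)%R
  ; cf_theta_ge : forall i, (i <= theta i)%R
  ; cf_sub : forall i, [set (x - y)%R | x in U i & y in U i] `<=` U (theta i)
  ; cf_doubling : forall i (x : G),
      mu (translate x (U (theta i))) <= D%:E * mu (translate x (U i)) }.

Definition symmetric_family (U : int -> set G) : Prop :=
  forall i, [set (- x)%R | x in U i] = U i.

Variable U : int -> set G.

Definition base_sets : set (set G) :=
  [set V | exists (x : G) (i : int), V = translate x (U i)].

(* In [\bar R], [0^-1 = +oo], [+oo^-1 = 0] and [0 * +oo = 0]. *)
Definition average (f : G -> \bar R) (V : set G) : \bar R :=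
  (mu V)^-1 * \int[mu]_(x in (V : set (borel G))) f x.

Definition maximal (f : G -> \bar R) (x : G) : \bar R :=
  ereal_sup [set average (fun y => `|f y|) V | V in base_sets `&` [set V | V x]].

(* Weights take values in [0, +oo], so that [w^(1-p')] is of the same type
   as [w] even where [w] vanishes. *)
Definition weight (w : G -> \bar R) : Prop :=
  [/\ forall x, 0 <= w x,
      measurable_fun [set: borel G] (w : borel G -> \bar R) &
      forall K : set G, compact K ->
        \int[mu]_(x in (K : set (borel G))) w x < +oo].

Definition conjugate_exponent (p : R) : R := (p / (p - 1))%R.

(* [w^(1-p')], written as [(w^(p'-1))^-1] in order that [0^(1-p') = +oo] and
   [+oo^(1-p') = 0]: with a negative exponent, the library's [`^] sends
   [0] to [0] and [+oo] to [+oo]. *)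
Definition dual_weight (p : R) (w : G -> \bar R) (x : G) : \bar R :=
  (w x `^ (conjugate_exponent p - 1))^-1.

Definition Ap_constant (p : R) (w : G -> \bar R) : \bar R :=
  ereal_sup [set average w V * average (dual_weight p w) V `^ (p - 1)
            | V in base_sets].

Definition Ap (p : R) (w : G -> \bar R) : Prop :=
  [/\ (1 < p)%R, weight w & Ap_constant p w < +oo].

Definition Ainfty_constant (w : G -> \bar R) : \bar R :=
  ereal_sup [set (\int[mu]_(x in (V : set (borel G))) w x)^-1 *
                 \int[mu]_(x in (V : set (borel G))) maximal (w \_ V) x
            | V in base_sets].

End covering_families.

(* Main.v *)
(* Write B = x + U_i, B' = x + U_theta(i), and let t0 be the mean of sigma over B'.
   The exponent p - eps turns the dual weight sigma into sigma^r, where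
   r = 1 + e = C[sigma]/(C[sigma] - 1), so that the theorem reduces to the reverse
   Hoelder inequality (mean of sigma^r over B)^(1/r) <= 2 D^4 t0.
   Let F be the maximal function of sigma over finitely many sets x' + U_n with
   x' in B and n <= i; all of them lie in B'. For t >= t0, a Vitali selection among
   those of mean > t which are of maximal scale for their centre gives
   sigma(F > t) <= D^4 t mu(F > t), since the dilates either have mean <= t or can
   be replaced by B'. The A_infinity condition on the dilates gives
   int_{F > t} F <= [sigma] D^4 t mu(F > t). Integrating the second bound against
   d(t^e) and absorbing (F is bounded) controls int F^r; the first one then controls
   int sigma F^e without a factor [sigma]. Finally the finite families increase to
   a family whose maximal function dominates sigma/(2 D^2) almost everywhere on B. *)
Require Import Defs.
From HB Require Import structures.
From mathcomp Require Import all_boot all_order all_algebra.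
From mathcomp Require Import all_classical all_reals all_analysis.
From mathcomp Require Import measurable_realfun.
From mathcomp Require Import ring lra zify.

Set Implicit Arguments.
Unset Strict Implicit.
Unset Printing Implicit Defensive.

Import Order.TTheory GRing.Theory Num.Theory.
Import numFieldNormedType.Exports.

Local Open Scope classical_set_scope.
Local Open Scope ring_scope.

(** * A layer-cake estimate over finitely many levels *)

(** Young's inequality for a and b^e, with exponents 1 + e and (1 + e)/e. It is the discrete form of
    t d(t^e) = e/(1+e) d(t^(1+e)), with t taken at the end [a]. *)
Lemma mulr_powRB_le (R : realType) (e a b : R) : 0 < e -> 0 <= a -> 0 <= b ->
  a * (b `^ e - a `^ e) <= e / (1 + e) * (b `^ (1 + e) - a `^ (1 + e)).
Proof.
move=> e0 a0 b0; have e10 : 0 < 1 + e by lra.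
have en : e != 0 by rewrite gt_eqF.
have e1n : 1 + e != 0 by rewrite gt_eqF.
have := @conjugate_powR R a (b `^ e) (1 + e) ((1 + e) / e) a0 (powR_ge0 _ _) e10.
rewrite divr_gt0// => /(_ isT).
have -> : (1 + e)^-1 + ((1 + e) / e)^-1 = 1 by field; rewrite ?en ?e1n.
move=> /(_ erefl); rewrite -powRrM.
have -> : e * ((1 + e) / e) = 1 + e by field.
rewrite invf_div => H.
have aa : a * a `^ e = a `^ (1 + e).
  by rewrite -(mulr_powRB1 a0 e10) addrAC subrr add0r.
rewrite mulrBr aa; move: H; set x := a `^ (1 + e); set y := b `^ (1 + e).
have -> : e / (1 + e) * (y - x) = x / (1 + e) + y * (e / (1 + e)) - x.
  by field.
lra.
Qed.

(** The increments of [phi] between consecutive levels telescope; they stop exactly at [u] because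
    [u], when above [t0], is itself a level. *)
Lemma sum_levels (R : realType) (phi : R -> R) (L : seq R) (t0 u : R) :
  path <%R t0 L -> (u <= t0) || (u \in L) ->
  \sum_(q <- zip (t0 :: L) L) (phi q.2 - phi q.1) * (q.1 < u)%R%:R =
  if u <= t0 then 0 else phi u - phi t0.
Proof.
elim: L t0 => [|v L IH] t0.
  by rewrite /= big_nil orbF => _ ->.
have -> : zip (t0 :: v :: L) (v :: L) = (t0, v) :: zip (v :: L) L by [].
rewrite big_cons [path _ _ _]/= [(_, _).1]/= [(_, _).2]/= => /andP[t0v pL] uL.
have uvL : (u <= v) || (u \in L).
  by move: uL; rewrite inE => /orP[/le_trans->|/predU1P[->|->]]; rewrite ?lexx ?orbT// ltW.
transitivity ((phi v - phi t0) * (t0 < u)%R%:R + (if u <= v then 0 else phi u - phi v)).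
  by congr (_ + _); exact: IH.
have [ut0|t0u] := leP u t0.
  by rewrite (le_trans ut0 (ltW t0v))// mulr0 addr0.
rewrite mulr1; move: uL; rewrite leNgt t0u /= inE => /predU1P[->|uL].
  by rewrite lexx addr0.
have vu : v < u by apply: (allP (order_path_min lt_trans pL)).
by rewrite leNgt vu/=; ring.
Qed.

Lemma mem_levels (R : realType) (L : seq R) (t0 : R) (q : R * R) :
  path <%R t0 L -> q \in zip (t0 :: L) L -> t0 <= q.1 < q.2.
Proof.
elim: L t0 => [//|v L IH] t0.
have -> : zip (t0 :: v :: L) (v :: L) = (t0, v) :: zip (v :: L) L by [].
rewrite [path _ _ _]/= => /andP[t0v pL].
rewrite inE => /predU1P[->/=|/(IH _ pL)/andP[vq ->]]; first by rewrite lexx.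
by rewrite (le_trans (ltW t0v) vq).
Qed.

Local Open Scope ereal_scope.

(* Layer cake for [F `^ e]. The finiteness of the set of values of [F] above [t0]
   replaces the integral over levels by a sum. *)
Lemma integral_mul_powR_le d (T : measurableType d) (R : realType)
    (mu : {measure set T -> \bar R}) (E : set T) (h : T -> \bar R) (F : T -> R)
    (L : seq R) (t0 c e : R) :
  measurable E -> measurable_fun setT h -> (forall y, 0 <= h y) ->
  measurable_fun setT F -> (forall y, 0 <= F y)%R ->
  (0 <= t0)%R -> (0 <= c)%R -> (0 < e)%R -> path <%R t0 L ->
  (forall y, (F y <= t0)%R || (F y \in L)) ->
  (forall t, (t0 <= t)%R -> \int[mu]_(y in E `&` [set y | (t < F y)%R]) h y <=
    (c * t)%:E * mu (E `&` [set y | (t < F y)%R])) ->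
  \int[mu]_(y in E) (h y * (F y `^ e)%:E) <=
    (t0 `^ e)%:E * \int[mu]_(y in E) h y +
    (c * (e / (1 + e)))%:E * \int[mu]_(y in E) (F y `^ (1 + e))%:E.
Proof.
move=> mE mh h0 mF F0 t00 c0 e0 pL FL H.
set A := fun t => [set y | (t < F y)%R].
have mA t : measurable (A t).
  rewrite (_ : A t = F @^-1` `]t, +oo[%classic).
    by rewrite -[X in measurable X]setTI; exact: mF.
  by apply/seteqP; split => y; rewrite /A /= in_itv/= andbT.
(* The absolute value makes this nonnegative for every pair, as the exchange of sum and integral
   requires; on consecutive levels it has no effect, by [wE]. *)
pose w (s : R) (q : R * R) := `|q.2 `^ s - q.1 `^ s|%R.
have wE s q : (0 < s)%R -> q \in zip (t0 :: L) L -> w s q = (q.2 `^ s - q.1 `^ s)%R.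
  move=> s0 /(mem_levels pL)/andP[tq qq]; rewrite /w ger0_norm// subr_ge0.
  by rewrite ge0_ler_powR ?nnegrE ?(ltW qq) ?(ltW s0)// (le_trans t00)// (le_trans tq)// ltW.
have sumE s y : (0 < s)%R -> (\sum_(q <- zip (t0 :: L) L) w s q * (q.1 < F y)%R%:R =
    if F y <= t0 then 0 else F y `^ s - t0 `^ s)%R.
  move=> s0; rewrite -(sum_levels (fun z => z `^ s)%R pL (FL y)).
  by rewrite big_seq [RHS]big_seq; apply: eq_bigr => q qL; rewrite wE.
have intA (k : T -> \bar R) t : measurable_fun setT k -> (forall y, 0 <= k y) ->
    \int[mu]_(y in E) (k y * (\1_(A t) y)%:E) = \int[mu]_(y in E `&` A t) k y.
  by move=> mk k0; rewrite integral_mkcondr; apply: eq_integral => y _; rewrite epatch_indic.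
have mind t : measurable_fun setT (fun y => (\1_(A t) y)%:E : \bar R).
  by apply/measurable_EFinP; exact: measurable_indic.
have indE t y : (\1_(A t) y = (t < F y)%R%:R :> R)%R.
  rewrite indicE; congr (_%:R); congr nat_of_bool; apply/idP/idP.
    by rewrite inE.
  by move=> ?; rewrite inE.
have w0 s q : 0 <= (w s q)%:E by rewrite lee_fin /w.
have i0 t y : 0 <= (\1_(A t) y)%:E :> \bar R by rewrite lee_fin.
have intS s (k : T -> \bar R) : measurable_fun setT k -> (forall y, 0 <= k y) ->
    \int[mu]_(y in E) (\sum_(q <- zip (t0 :: L) L) (w s q)%:E * (k y * (\1_(A q.1) y)%:E)) =
    \sum_(q <- zip (t0 :: L) L) (w s q)%:E * \int[mu]_(y in E `&` A q.1) k y.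
  move=> mk k0; have mkA q : measurable_fun E (fun y => k y * (\1_(A q) y)%:E).
    apply: emeasurable_funM; first exact: measurable_funTS.
    exact/measurable_funTS/mind.
  rewrite ge0_integral_sum//; last 2 first.
  - by move=> q; exact: measurable_funeM.
  - by move=> q y _; rewrite mule_ge0 ?mule_ge0 ?w0 ?i0.
  by apply: eq_bigr => q _; rewrite ge0_integralZl ?w0// ?intA// => y _; rewrite mule_ge0 ?i0.
have mFs s : measurable_fun setT (fun y => (F y `^ s)%:E).
  by apply/measurable_EFinP; exact: (measurableT_comp (measurable_powR _)).
pose S := fun s (k : T -> \bar R) y =>
  \sum_(q <- zip (t0 :: L) L) (w s q)%:E * (k y * (\1_(A q.1) y)%:E).
have SE s k y : (0 < s)%R -> 0 <= k y ->
    S s k y = k y * (if F y <= t0 then 0 else F y `^ s - t0 `^ s)%R%:E.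
  move=> s0 k0; rewrite -sumE// -sumEFin ge0_sume_distrr; last first.
    by move=> q _; rewrite lee_fin mulr_ge0// /w.
  by apply: eq_bigr => q _; rewrite EFinM indE muleCA.
have S_ge0 s k y : 0 <= k y -> 0 <= S s k y.
  by move=> k0; rewrite sume_ge0// => q _; rewrite mule_ge0 ?mule_ge0 ?w0 ?i0.
have mS s k : measurable_fun setT k -> measurable_fun setT (S s k).
  move=> mk; apply: emeasurable_sum => q; apply: measurable_funeM.
  by apply: emeasurable_funM => //; exact: mind.
have mhE : measurable_fun E h by exact: measurable_funTS.
(* F^e is at most t0^e plus the positive part of F^e - t0^e, and the latter is the sum over
   levels. *)
apply: (@le_trans _ _ (\int[mu]_(y in E) ((t0 `^ e)%:E * h y + S e h y))).
  apply: ge0_le_integral => //.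
  - by move=> y _; rewrite mule_ge0// lee_fin powR_ge0.
  - by apply: emeasurable_funM => //; exact/measurable_funTS.
  - by apply: emeasurable_funD; [exact: measurable_funeM|exact/measurable_funTS/mS].
  move=> y _; rewrite SE// [X in X + _]muleC -ge0_muleDr ?lee_fin ?powR_ge0//; last first.
    case: ifPn => //; rewrite -ltNge => t0F.
    by rewrite subr_ge0 ge0_ler_powR ?nnegrE// ltW.
  apply: lee_wpmul2l => //; rewrite -EFinD lee_fin.
  case: ifPn => [Ft|_]; last by rewrite addrC subrK.
  by rewrite addr0 ge0_ler_powR ?nnegrE// ltW.
rewrite ge0_integralD//; last 4 first.
- by move=> y _; rewrite mule_ge0// lee_fin powR_ge0.
- exact: measurable_funeM.
- by move=> y _; exact: S_ge0.
- exact/measurable_funTS/mS.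
rewrite ge0_integralZl ?lee_fin ?powR_ge0//; apply: leeD => //.
rewrite intS//; set c' := (c * (e / (1 + e)))%R.
have e10 : (0 < 1 + e)%R by rewrite addr_gt0.
have c'0 : (0 <= c')%R by rewrite mulr_ge0// divr_ge0// ltW.
(* For two consecutive levels the hypothesis is used at the lower one; [mulr_powRB_le] then turns
   the increment of t^e into that of t^(1+e). *)
apply: (@le_trans _ _ (\sum_(q <- zip (t0 :: L) L)
    c'%:E * ((w (1 + e) q)%:E * \int[mu]_(y in E `&` A q.1) cst 1 y))).
  rewrite big_seq [leRHS]big_seq; apply: lee_sum => q qL.
  have /andP[tq qq] := mem_levels pL qL.
  rewrite integral_cst ?mul1e; last exact: measurableI.
  apply: (@le_trans _ _ ((w e q)%:E * ((c * q.1)%:E * mu (E `&` A q.1)))).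
    by apply: lee_wpmul2l; [exact: w0|exact: H].
  rewrite !muleA; apply: lee_wpmul2r => //.
  rewrite -!EFinM lee_fin mulrCA /c' -mulrA; apply: ler_wpM2l => //.
  rewrite mulrC !wE//; apply: mulr_powRB_le => //; first exact: le_trans tq.
  by rewrite (le_trans t00)// (le_trans tq)// ltW.
rewrite -ge0_sume_distrr; last first.
  by move=> q _; rewrite mule_ge0 ?w0// integral_ge0.
apply: lee_wpmul2l; first by rewrite lee_fin.
(* Summed back with the constant 1 in place of [h], the levels give the positive part of F^(1+e) -
   t0^(1+e). *)
rewrite -intS//; apply: ge0_le_integral => //.
- by move=> y _; apply: S_ge0.
- by apply: measurable_funTS; apply: mS.
- exact: measurable_funTS.
move=> y _; rewrite -/(S _ _ _) SE// mul1e lee_fin.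
by case: ifPn => _; rewrite ?powR_ge0// lerBlDr lerDl powR_ge0.
Qed.

(** * Translations and Borel sets *)

Section translates.
Context {G : topologicalZmodType}.

Lemma translateE (x : G) (A : set G) y : translate x A y <-> A (y - x)%R.
Proof.
split; first by case=> z Az <-; rewrite addrAC subrr add0r.
by move=> Ayx; exists (y - x)%R => //; rewrite addrC subrK.
Qed.

Lemma translate_preimage (x : G) (A : set G) :
  translate x A = (fun y => y - x)%R @^-1` A.
Proof. by apply/seteqP; split => y /translateE. Qed.

Lemma subr_continuous (x : G) : continuous (fun y : G => y - x)%R.
Proof.
move=> y; apply: (@continuous_comp _ _ _ (fun y => (y, x))
  (fun z : G * G => z.1 - z.2)%R); last exact: sub_continuous.
by apply: cvg_pair => /=; [exact: cvg_id|exact: cvg_cst].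
Qed.

Lemma addr_continuous (x : G) : continuous (fun y : G => x + y)%R.
Proof.
move=> y; apply: (@continuous_comp _ _ _ (fun y => (x, y))
  (fun z : G * G => z.1 + z.2)%R); last exact: add_continuous.
by apply: cvg_pair => /=; [exact: cvg_cst|exact: cvg_id].
Qed.

Lemma subl_continuous (x : G) : continuous (fun y : G => x - y)%R.
Proof.
move=> y; apply: (@continuous_comp _ _ _ (fun y => (x, y))
  (fun z : G * G => z.1 - z.2)%R); last exact: sub_continuous.
by apply: cvg_pair => /=; [exact: cvg_cst|exact: cvg_id].
Qed.

Lemma measurable_open (A : set G) : open A -> measurable (A : set (borel G)).
Proof. by move=> oA; exact: (@sub_sigma_algebra G setT (@open G)). Qed.

Lemma measurable_closed (A : set G) : closed A -> measurable (A : set (borel G)).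
Proof.
by move=> /closed_openC/measurable_open/measurableC; rewrite setCK.
Qed.

Lemma continuous_measurable_borel (f : G -> G) : continuous f ->
  measurable_fun setT (f : borel G -> borel G).
Proof.
move=> cf _ /= A mA; rewrite setTI.
pose S := [set A : set (borel G) | measurable (f @^-1` A : set (borel G))].
have : <<s @open G >> `<=` S.
  apply: smallest_sub.
    split.
    - by rewrite /S /= preimage_set0.
    - move=> B SB; rewrite /S /= setTD preimage_setC; exact: measurableC.
    - move=> B SB; rewrite /S /= preimage_bigcup; exact: bigcupT_measurable.
  move=> B oB; rewrite /S /=; apply: measurable_open.
  by move/continuousP : cf; apply.
by apply.
Qed.

Lemma measurable_translate (x : G) (A : set G) :
  measurable (A : set (borel G)) -> measurable (translate x A : set (borel G)).
Proof.
move=> mA; rewrite translate_preimage -[X in measurable X]setTI.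
exact: (continuous_measurable_borel (@subr_continuous x)).
Qed.

Lemma compact_translate (x : G) (A : set G) : compact A -> compact (translate x A).
Proof.
move=> cA; apply: continuous_compact => //.
exact/continuous_subspaceT/addr_continuous.
Qed.

End translates.

(** * Inclusions between base sets, and doubling *)

Section covering_geometry.
Context {R : realType} {G : topologicalZmodType} (mu : {measure set (borel G) -> \bar R}).
Context (U : int -> set G) (D : R) (theta : int -> int).
Hypotheses (hG : hausdorff_space G) (mu_fin : finite_on_compacts mu).
Hypotheses (hU : covering_family mu U D theta) (symU : symmetric_family U).

Local Notation T x n := (translate x (U n)).

Lemma covering0 n : U n 0%R.
Proof. exact: nbhs_singleton (cf_nbhs hU n). Qed.

Lemma coveringN n z : U n z -> U n (- z)%R.
Proof. by move=> Uz; rewrite -(symU n); exists z. Qed.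

Lemma coveringB n y z : U n y -> U n z -> U (theta n) (y - z)%R.
Proof. by move=> Uy Uz; apply: (cf_sub hU); exists y => //; exists z. Qed.

Lemma coveringD n y z : U n y -> U n z -> U (theta n) (y + z)%R.
Proof. by move=> Uy /coveringN/(coveringB Uy); rewrite opprK. Qed.

Lemma covering_le m n : (m <= n)%R -> U m `<=` U n.
Proof. exact: (cf_increasing hU). Qed.

Lemma doubling_ge0 : (0 <= D)%R.
Proof. exact: le_trans (cf_doubling_ge1 hU). Qed.

Lemma translate_center x n : T x n x.
Proof. by apply/translateE; rewrite subrr; exact: covering0. Qed.

Lemma translate_sym x y n : T x n y -> T y n x.
Proof. by move=> /translateE/coveringN; rewrite opprB => ?; apply/translateE. Qed.

Lemma translate_le x m n : (m <= n)%R -> T x m `<=` T x n.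
Proof. by move=> mn y /translateE Uy; apply/translateE; exact: covering_le Uy. Qed.

Lemma translate_theta x n : T x n `<=` T x (theta n).
Proof. exact: translate_le (cf_theta_ge hU n). Qed.

Lemma translate_sub x y m n : (m <= n)%R -> T x n y -> T y m `<=` T x (theta n).
Proof.
move=> mn /translateE Uxy z /translateE /(covering_le mn) Uyz; apply/translateE.
by rewrite -(subrK y z) -addrA; exact: coveringD.
Qed.

(** One dilation catches the centre [y], a second one all of [T y m]. This is the engulfing property
    that Vitali selections rely on. *)
Lemma translate_meet x y m n : (m <= n)%R -> T y m `&` T x n !=set0 ->
  T y m `<=` T x (theta (theta n)).
Proof.
move=> mn [z [yz xz]] u yu.
have xy : T x (theta n) y.
  by apply: translate_sub xz _ _ => //; exact: translate_sym (translate_le mn yz).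
by apply: translate_sub xy _ yu; exact: le_trans mn (cf_theta_ge hU n).
Qed.

Lemma measurable_base x n : measurable (T x n : set (borel G)).
Proof. exact: measurable_translate (cf_borel hU n). Qed.

Lemma measurable_compact (K : set G) : compact K -> measurable (K : set (borel G)).
Proof. by move=> cK; apply: measurable_closed; exact: compact_closed. Qed.

Lemma base_compact x n : exists2 K : set G, compact K & T x n `<=` K.
Proof.
exists (translate x (closure (U n))).
  by apply: compact_translate; rewrite -precompactE; exact: (cf_precompact hU).
by move=> y /translateE Uy; apply/translateE; exact: subset_closure.
Qed.

Lemma base_lty x n : mu (T x n) < +oo.
Proof.
have [K cK TK] := base_compact x n.
apply: le_lt_trans (mu_fin cK); apply: le_measure => //; rewrite inE.
  exact: measurable_base.
exact: measurable_compact.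
Qed.

Lemma base_doubling k x n : mu (T x (iter k theta n)) <= (D ^+ k)%:E * mu (T x n).
Proof.
elim: k => [|k IH]; first by rewrite expr0 mul1e.
apply: le_trans (cf_doubling hU _ _) _.
by rewrite exprS EFinM -muleA lee_wpmul2l// lee_fin doubling_ge0.
Qed.

Lemma iter_theta_le k m n : (m <= n)%R -> (iter k theta m <= iter k theta n)%R.
Proof. by move=> mn; elim: k => //= k IH; exact: (cf_theta_increasing hU). Qed.

Lemma base_le_doubling k (A : set G) x n : measurable (A : set (borel G)) ->
  A `<=` T x (iter k theta n) -> mu A <= (D ^+ k)%:E * mu (T x n).
Proof.
move=> mA AT; apply: le_trans (base_doubling k x n).
by apply: le_measure => //; rewrite inE//; exact: measurable_base.
Qed.

(** Some [U m] contains [x - y], since the family exhausts the group. This will spread an infinite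
    integral from one base set to all others. *)
Lemma base_absorb x y i j : exists k, T x i `|` T y j `<=` T y k.
Proof.
have : [set: G] (x - y)%R by [].
rewrite -(cf_cover hU) => -[m _ Um].
pose n := Num.max (Num.max m i) j; exists (theta n) => z [xz|yz].
  have xn : T y n x by apply/translateE; apply: covering_le Um; rewrite /n !le_max lexx.
  by apply: translate_sub xn _ xz; rewrite /n !le_max lexx orbT.
by apply/translate_theta/(translate_le _ yz); rewrite /n !le_max lexx orbT.
Qed.

Hypothesis theta_lt : forall i, (i < theta i)%R.

Lemma iter_theta_ge k n : (n + k%:Z <= iter k theta n)%R.
Proof.
elim: k => [|k IH]; first by rewrite addr0.
by have := theta_lt (iter k theta n) => /=; lia.
Qed.

(** Because [theta] strictly raises the scale, the iterated dilates of a single base set exhaust the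
    group, and doubling makes each of them null. *)
Lemma null_base x n : mu (T x n) = 0 -> mu setT = 0.
Proof.
move=> T0; have -> : [set: borel G] = \bigcup_k T x (iter k theta n).
  apply/esym; rewrite -subTset => y _.
  have : [set: G] (y - x)%R by [].
  rewrite -(cf_cover hU) => -[m _ Um].
  exists `|m - n|%N => //; apply/translateE; apply: covering_le Um.
  by have := iter_theta_ge `|m - n|%N n; lia.
apply: measure_negligible.
  by apply: bigcupT_measurable => k; exact: measurable_base.
apply: negligible_bigcup => k; apply/negligibleP; first exact: measurable_base.
apply/eqP; rewrite eq_le measure_ge0 andbT.
by rewrite (le_trans (base_doubling k x n))// T0 mule0.
Qed.

End covering_geometry.

(** * Vitali selection and maximal functions of finite families *)

Section finite_families.

Lemma exists_maximal (I : eqType) (scale : I -> int) (S : seq I) s : s \in S ->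
  exists2 s0, s0 \in S & forall s', s' \in S -> (scale s' <= scale s0)%R.
Proof.
elim: S s => // a S IH s _.
have [S0|[b bS]] : S = [::] \/ exists b, b \in S.
  by case: (S) => [|b S']; [left|right; exists b; rewrite mem_head].
- by exists a; rewrite ?mem_head// => s'; rewrite S0 mem_seq1 => /eqP ->.
have [c cS cmax] := IH b bS.
have [ac|ca] := leP (scale a) (scale c).
- exists c; first by rewrite inE cS orbT.
  by move=> s'; rewrite inE => /predU1P[->//|]; exact: cmax.
exists a; rewrite ?mem_head// => s'; rewrite inE => /predU1P[->//|/cmax/le_trans].
by apply; exact: ltW.
Qed.

(** Greedy choice: take a set of largest scale, discard all sets that meet it, and recurse. The
    chosen set meets itself, being nonempty, so the list gets shorter. *)
Lemma vitali_selection (I : eqType) (T : Type) (V : I -> set T) (scale : I -> int)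
    (S : seq I) : (forall s, V s !=set0) ->
  exists S', [/\ uniq S', {subset S' <= S}, trivIset [set` S'] V &
    forall s, s \in S -> exists s', [/\ s' \in S', (scale s <= scale s')%R &
      V s `&` V s' !=set0]].
Proof.
move=> V0; have [m] := ubnP (size S); elim: m S => // m IH [_|a S0].
  by exists [::]; split => // x y /=; rewrite in_nil.
set S := a :: S0; rewrite ltnS => Sm.
have [b bS bmax] := exists_maximal scale (mem_head a S0 : a \in S).
pose P s := `[< V s `&` V b = set0 >].
have PN s : ~~ P s -> V s `&` V b !=set0 by move=> /asboolP/eqP; rewrite set0P.
have nPb : ~~ P b by apply/negP => /asboolP; rewrite setIid; exact/eqP/set0P.
have Pm : (size [seq s <- S | P s] < m)%N.
  apply: leq_trans Sm; rewrite size_filter -(count_predC P S) -addn1 leq_add2l.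
  by rewrite -has_count; apply/hasP; exists b.
have [S' [uS' S'P tS' S'max]] := IH _ Pm.
have S'b s : s \in S' -> V s `&` V b = set0.
  by move=> /S'P; rewrite mem_filter => /andP[/asboolP].
exists (b :: S'); split.
- rewrite /= uS' andbT; apply/negP => /S'P; rewrite mem_filter => /andP[Pb _].
  by rewrite Pb in nPb.
- move=> s; rewrite inE => /predU1P[->//|/S'P]; by rewrite mem_filter => /andP[].
- move=> s s' /=; rewrite !inE => /predU1P[->|sS'] /predU1P[->|s'S'] //.
  + by rewrite setIC S'b// => /set0P; rewrite eqxx.
  + by rewrite S'b// => /set0P; rewrite eqxx.
  + exact: tS'.
- move=> s sS; have [Ps|/PN sb] := boolP (P s); last first.
    by exists b; rewrite mem_head; split => //; exact: bmax.
  have [|s' [s'S' ss' ne]] := S'max s; first by rewrite mem_filter Ps.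
  by exists s'; rewrite inE s'S' orbT.
Qed.

Context {R : realType} {I : eqType} {T : Type} (v : I -> R) (V : I -> set T).

(** With averages for [v], this is the maximal function over the family [S]. It takes finitely many
    values, the value 0 covering the points outside all sets. *)
Definition finite_maximal (S : seq I) (y : T) : R :=
  \big[Num.max/0%R]_(s <- S) (v s * \1_(V s) y)%R.

Lemma finite_maximal_ge0 S y : (0 <= finite_maximal S y)%R.
Proof.
by rewrite /finite_maximal; elim: S => [|s S IH]; rewrite ?big_nil// big_cons le_max IH orbT.
Qed.

Lemma finite_maximal_ge S s y : s \in S -> V s y -> (v s <= finite_maximal S y)%R.
Proof.
move=> sS Vy; have := @le_bigmax_seq _ _ _ S 0%R s xpredT (fun s => v s * \1_(V s) y)%R sS isT.
by rewrite indicE mem_set// mulr1.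
Qed.

Lemma finite_maximalP S y : finite_maximal S y = 0%R \/
  exists s, [/\ s \in S, V s y & finite_maximal S y = v s].
Proof.
rewrite /finite_maximal; elim: S => [|s S IH]; first by left; rewrite big_nil.
rewrite big_cons.
have [le|lt] := leP (v s * \1_(V s) y)%R
  (\big[Num.max/0%R]_(s <- S) (v s * \1_(V s) y)%R).
  by case: IH => [->|[s' [s'S Vy ->]]]; [left|right; exists s'; rewrite inE s'S orbT].
rewrite indicE; have [/set_mem Vy|_] := boolP (y \in V s); last by left; rewrite mulr0.
by right; exists s; rewrite mulr1 mem_head.
Qed.

Lemma finite_maximal_gtP S y t : (0 <= t)%R -> (t < finite_maximal S y)%R <->
  exists s, [/\ s \in S, V s y & (t < v s)%R].
Proof.
move=> t0; split=> [tF|[s [sS Vy tv]]]; last exact: lt_le_trans (finite_maximal_ge sS Vy).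
case: (finite_maximalP S y) => [F0|[s [sS Vy Fv]]]; last by exists s; rewrite -Fv.
by move: tF; rewrite F0 ltNge t0.
Qed.

Lemma finite_maximal_sub S S' y : {subset S <= S'} ->
  (finite_maximal S y <= finite_maximal S' y)%R.
Proof.
move=> SS'; case: (finite_maximalP S y) => [->|[s [sS Vy ->]]]; first exact: finite_maximal_ge0.
exact: finite_maximal_ge (SS' _ sS) Vy.
Qed.

End finite_families.

Lemma measurable_finite_maximal d (T : measurableType d) (R : realType) (I : eqType)
  (v : I -> R) (V : I -> set T) (S : seq I) : (forall s, measurable (V s)) ->
  measurable_fun setT (finite_maximal v V S).
Proof.
move=> mV; elim: S => [|s S IH].
  have -> : finite_maximal v V [::] = cst 0%R.
    by apply/funext => y; rewrite /finite_maximal big_nil.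
  exact: measurable_cst.
have -> : finite_maximal v V (s :: S) =
    (fun y => v s * \1_(V s) y)%R \max finite_maximal v V S.
  by apply/funext => y; rewrite /finite_maximal big_cons.
apply: measurable_maxr => //; apply: measurable_funM => //.
Qed.

Section finite_selection.
Context d (T : measurableType d) (R : realType) (mu : {measure set T -> \bar R}).
Context {I : choiceType} (V : I -> set T).
Hypothesis mV : forall s, measurable (V s).

Lemma sum_measure_trivIset (S : seq I) (A : set T) : measurable A -> uniq S ->
  trivIset [set` S] V -> (forall s, s \in S -> V s `<=` A) ->
  \sum_(s <- S) mu (V s) <= mu A.
Proof.
move=> mA uS tS SA.
have int1 B : measurable B -> mu B = \int[mu]_(x in B) cst 1 x.
  by move=> mB; rewrite integral_cst// mul1e.
under eq_bigr do rewrite int1//.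
rewrite -ge0_integral_bigsetU//= -int1.
  apply: le_measure; rewrite ?inE//; first exact: bigsetU_measurable.
  by rewrite -bigcup_seq; apply: bigcup_sub => s; exact: SA.
exact: bigsetU_measurable.
Qed.

(** The covering argument in abstract form: [h] is dominated by the sum of the [k s], and
    disjointness bounds the sum of the [mu (V s)] by [mu A]. In the applications [k s] is carried by
    a dilate of [V s]. *)
Lemma integral_le_sum_selection (S : seq I) (A : set T) (h : T -> \bar R)
    (k : I -> T -> \bar R) (c : \bar R) : measurable A -> uniq S ->
  trivIset [set` S] V -> (forall s, s \in S -> V s `<=` A) -> 0 <= c ->
  measurable_fun A h -> (forall y, A y -> 0 <= h y) ->
  (forall s, measurable_fun A (k s)) -> (forall s y, A y -> 0 <= k s y) ->
  (forall y, A y -> exists2 s, s \in S & h y <= k s y) ->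
  (forall s, s \in S -> \int[mu]_(y in A) k s y <= c * mu (V s)) ->
  \int[mu]_(y in A) h y <= c * mu A.
Proof.
move=> mA uS tS SA c0 mh h0 mk k0 hk kc.
apply: (@le_trans _ _ (\int[mu]_(y in A) \sum_(s <- S) k s y)).
  apply: ge0_le_integral => //; first exact: emeasurable_sum.
  move=> y Ay; have [s sS hs] := hk y Ay; apply: le_trans hs _.
  rewrite (big_rem s)//= leeDl// sume_ge0// => s' _; exact: k0.
rewrite ge0_integral_sum//.
apply: (@le_trans _ _ (\sum_(s <- S) c * mu (V s))).
  by rewrite big_seq [leRHS]big_seq; exact: lee_sum.
rewrite -ge0_sume_distrr//; apply: lee_wpmul2l => //.
exact: sum_measure_trivIset.
Qed.

End finite_selection.

(** The integral of a nonnegative function is the supremum over the simple functions below it, so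
    monotonicity also holds for nonmeasurable integrands such as maximal functions. *)
Lemma ge0_le_lower_integral d (T : measurableType d) (R : realType)
    (mu : {measure set T -> \bar R}) (E : set T) (f g : T -> \bar R) :
  (forall y, E y -> 0 <= f y) -> (forall y, E y -> f y <= g y) ->
  \int[mu]_(y in E) f y <= \int[mu]_(y in E) g y.
Proof.
move=> f0 fg; rewrite !ge0_integralE//; last first.
  by move=> y Ey; rewrite (le_trans (f0 y Ey))// fg.
apply: ereal_sup_le => _ [h /= hf <-]; exists h => // y /=.
by rewrite (le_trans (hf y))//; exact: lee_restrict.
Qed.

(** * The reverse Hoelder inequality for finite families *)

Section reverse_holder.
Context {R : realType} {G : topologicalZmodType} (mu : {measure set (borel G) -> \bar R}).
Context (U : int -> set G) (D : R) (theta : int -> int).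
Hypotheses (hG : hausdorff_space G) (mu_fin : finite_on_compacts mu).
Hypotheses (hU : covering_family mu U D theta) (symU : symmetric_family U).
Hypothesis theta_lt : forall i, (i < theta i)%R.

Local Notation T x n := (translate x (U n)).
Local Notation V q := (translate q.1 (U q.2)).

Hypothesis mu_gt0 : forall x n, 0 < mu (T x n).
Context (f : G -> \bar R).
Hypotheses (mf : measurable_fun setT (f : borel G -> \bar R)) (f0 : forall y, 0 <= f y).
Hypothesis f_lty : forall x n, \int[mu]_(y in (T x n : set (borel G))) f y < +oo.

(** A real-valued version of [average], indexed by centre and scale so that finite families are
    sequences of pairs; [averageE] relates the two. *)
Definition base_average (q : G * int) : R :=
  fine (\int[mu]_(y in (V q : set (borel G))) f y) / fine (mu (V q)).

Local Notation v := base_average.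

Lemma base_average_ge0 q : (0 <= v q)%R.
Proof. by rewrite divr_ge0// fine_ge0// integral_ge0. Qed.

Lemma base_fin_num q : mu (V q) \is a fin_num.
Proof. by rewrite ge0_fin_numE//; exact: (base_lty hG mu_fin hU). Qed.

Lemma base_averageE q :
  \int[mu]_(y in (V q : set (borel G))) f y = (v q)%:E * mu (V q).
Proof.
have fi : \int[mu]_(y in (V q : set (borel G))) f y \is a fin_num.
  by rewrite ge0_fin_numE// integral_ge0.
rewrite -[LHS]fineK// -[mu _]fineK ?base_fin_num// -EFinM divfK//.
by rewrite gt_eqF// fine_gt0// mu_gt0 (base_lty hG mu_fin hU).
Qed.

Lemma averageE (g : G -> \bar R) q :
  (forall y, V q y -> g y = f y) -> average mu g (V q) = (v q)%:E.
Proof.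
move=> gf; rewrite /average (eq_integral (f : borel G -> \bar R)); last first.
  by move=> y /set_mem; exact: gf.
rewrite base_averageE -[mu _]fineK ?base_fin_num//.
have m0 : fine (mu (V q)) != 0%R by rewrite gt_eqF// fine_gt0// mu_gt0 (base_lty hG mu_fin hU).
by rewrite inver (negbTE m0) -!EFinM mulrCA mulVf// mulr1.
Qed.

Lemma maximal_ge0 (g : G -> \bar R) y : 0 <= maximal mu U g y.
Proof.
apply: (@le_trans _ _ (average mu (fun z => `|g z|) (T y 0))).
  by rewrite /average mule_ge0 ?inve_ge0// integral_ge0.
apply: ereal_sup_ubound; exists (T y 0) => //; split; first by exists y, 0%R.
exact: translate_center hU _ _.
Qed.

Lemma base_average_le_maximal q q' y : V q `<=` V q' -> V q y ->
  (v q)%:E <= maximal mu U (f \_ (V q')) y.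
Proof.
move=> qq' qy; rewrite -(@averageE (fun z => `|(f \_ (V q')) z|)).
  by apply: ereal_sup_ubound; exists (V q) => //; split => //; exists q.1, q.2.
by move=> z /qq' /mem_set zq'; rewrite patchE zq' gee0_abs.
Qed.

Section finite_subfamily.
Context (x0 : G) (i : int) (S : seq (G * int)).
Hypothesis S_closed : forall q, q \in S -> [/\ T x0 i q.1, (q.2 <= i)%R &
  forall n, (q.2 <= n <= i)%R -> (q.1, n) \in S].

Local Notation Bh := (T x0 (theta i)).
Local Notation t0 := (v (x0, theta i)).
Local Notation F := (finite_maximal v (fun q => V q) S).

(** For each centre only the largest scale up to [i] with average above [t] matters, and Vitali
    selection is applied to these sets. If the double dilate of a selected set has scale at most
    [i], its average is at most [t] by maximality; otherwise the set is comparable with [Bh], whose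
    average is [t0]. [S_closed] makes maximality within [S] a maximality among all scales up to
    [i]. *)
Lemma level_selection t : (t0 <= t)%R -> exists (S' : seq (G * int)) (Q : G * int -> G * int),
  [/\ uniq S', trivIset [set` S'] (fun q => V q), forall q, q \in S' -> q \in S /\ (t < v q)%R,
   forall q, q \in S -> (t < v q)%R -> exists2 q', q' \in S' & V q `<=` V (Q q') &
   forall q, q \in S' ->
     \int[mu]_(y in (V (Q q) : set (borel G))) f y <= (D ^+ 4 * t)%:E * mu (V q)].
Proof.
move=> t0t; have t_ge0 : (0 <= t)%R := le_trans (base_average_ge0 _) t0t.
pose P q := `[< (t < v q)%R /\ forall n, (q.2 < n <= i)%R -> (v (q.1, n) <= t)%R >].
have [|S' [uS' S'P tS' S'max]] := @vitali_selection (G * int)%type G (fun q => V q) snd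
    [seq q <- S | P q].
  by move=> q; exists q.1; exact: translate_center hU _ _.
(* Beyond scale [i] the dilate is not controlled by [t]; [Bh] replaces it. *)
pose Q q := if (theta (theta q.2) <= i)%R then (q.1, theta (theta q.2)) else (x0, theta i).
have S'S q : q \in S' -> [/\ q \in S, (t < v q)%R &
    forall n, (q.2 < n <= i)%R -> (v (q.1, n) <= t)%R].
  by move=> /S'P; rewrite mem_filter => /andP[/asboolP[]].
exists S', Q; split => //.
- by move=> q /S'S[].
- move=> q qS tq.
  (* [q1] is the largest set of [S] with the centre of [q] and average above [t]; it contains [V q]
     and enters the selection. *)
  have [|q1 + q1max] := @exists_maximal _ (snd : G * int -> int)
      [seq q' <- S | (q'.1 == q.1) && (t < v q')%R] q.
    by rewrite mem_filter eqxx tq.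
  rewrite mem_filter => /andP[/andP[/eqP q1q tq1] q1S].
  have qq1 : (q.2 <= q1.2)%R by apply: q1max; rewrite mem_filter eqxx tq.
  have Pq1 : P q1.
    apply/asboolP; split => // n /andP[q1n ni]; rewrite leNgt; apply/negP => tn.
    have [_ _ /(_ n)] := S_closed q1S; rewrite (ltW q1n) ni => /(_ isT) nS.
    have := q1max (q1.1, n); rewrite mem_filter nS tn q1q eqxx => /(_ isT) /=.
    by rewrite leNgt q1n.
  have [|q' [q'S' q1q' ne]] := S'max q1; first by rewrite mem_filter Pq1.
  exists q' => //; apply: (@subset_trans _ (V q1)).
    by rewrite -q1q; exact: (translate_le hU qq1).
  rewrite /Q; case: ifPn => _ /=.
    exact: (translate_meet hU symU q1q' ne).
  by have [q1x0 q1i _] := S_closed q1S; exact: (translate_sub hU symU q1i q1x0).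
move=> q /S'S[qS tq qmax]; rewrite /Q; case: ifPn => /= [thi|].
  rewrite (base_averageE (q.1, theta (theta q.2))).
  apply: (@le_trans _ _ (t%:E * ((D ^+ 2)%:E * mu (V q)))).
    apply: lee_pmul => //; first by rewrite lee_fin base_average_ge0.
      rewrite lee_fin; apply: qmax; rewrite thi andbT.
      exact: lt_trans (theta_lt _) (theta_lt _).
    exact: (base_doubling hU 2).
  rewrite muleA -EFinM lee_wpmul2r// lee_fin mulrC ler_wpM2r//.
  by rewrite ler_weXn2l// (cf_doubling_ge1 hU).
rewrite -ltNge => ith; have [qx0 qi _] := S_closed qS.
(* Four dilations, hence D^4: [Bh] lies in the set of centre [q.1] and scale [theta (theta i)], and
   [i] is below [theta (theta q.2)]. *)
rewrite (base_averageE (x0, theta i)) (mulrC (D ^+ 4)%R) (EFinM t) -muleA.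
apply: lee_pmul => //; first by rewrite lee_fin base_average_ge0.
apply: (base_le_doubling hU); first exact: measurable_base hU _ _.
apply: (@subset_trans _ (T q.1 (theta (theta i)))).
  apply: (translate_sub hU symU) => //.
  exact/(translate_theta hU)/(translate_sym symU).
apply: (translate_le hU); apply: (iter_theta_le hU 2); exact: ltW.
Qed.

Lemma level_set_sub t y : (t0 <= t)%R -> (t < F y)%R -> Bh y.
Proof.
move=> t0t; have t_ge0 : (0 <= t)%R := le_trans (base_average_ge0 _) t0t.
move=> /(finite_maximal_gtP _ _ S y t_ge0)[q [/S_closed[qx0 qi _] qy _]].
exact: (translate_sub hU symU qi qx0).
Qed.

Let Om t : set (borel G) := Bh `&` [set y | (t < F y)%R].

Let mF : measurable_fun setT (F : borel G -> R).
Proof. by apply: measurable_finite_maximal => q; exact: measurable_base hU _ _. Qed.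

Let mOm t : measurable (Om t).
Proof.
apply: measurableI; first exact: measurable_base hU _ _.
rewrite (_ : [set y | _] = F @^-1` `]t, +oo[%classic).
  by rewrite -[X in measurable X]setTI; exact: mF.
by apply/seteqP; split => y; rewrite /= in_itv/= andbT.
Qed.

(** Common form of the two level-set bounds. At a point of the level set, [F] is attained on some
    [V q] with average above [t]; this set lies in a dilate [V (Q q')] of a selected one, where
    [k (Q q')] dominates [h]. *)
Lemma level_selection_integral t (c : R) (h : G -> \bar R) (k : G * int -> G -> \bar R) :
  (t0 <= t)%R -> (0 <= c)%R ->
  measurable_fun setT (h : borel G -> \bar R) -> (forall y, 0 <= h y) ->
  (forall q, measurable_fun setT (k q : borel G -> \bar R)) -> (forall q y, 0 <= k q y) ->
  (forall q, \int[mu]_(y in (V q : set (borel G))) k q y <=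
     c%:E * \int[mu]_(y in (V q : set (borel G))) f y) ->
  (forall q y, ~ V q y -> k q y = 0) ->
  (forall q q' y, q \in S -> V q y -> V q `<=` V q' -> F y = v q -> h y <= k q' y) ->
  \int[mu]_(y in Om t) h y <= (c * D ^+ 4 * t)%:E * mu (Om t).
Proof.
move=> t0t c0 mh h0 mk k0 kf kV hk; have t_ge0 : (0 <= t)%R := le_trans (base_average_ge0 _) t0t.
have [S' [Q [uS' tS' S'S SQ Qf]]] := level_selection t0t.
apply: (@integral_le_sum_selection _ _ _ mu _ (fun q => V q : set (borel G)) _ S' _ h
  (fun q => k (Q q))) => //.
- by move=> q; exact: measurable_base hU _ _.
- move=> q /S'S[qS tq] y qy; have tF : (t < F y)%R.
    exact: lt_le_trans tq (finite_maximal_ge v (V := fun q => V q) qS qy).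
  by split => //; exact: level_set_sub tF.
- by rewrite lee_fin mulr_ge0 ?(mulr_ge0 c0) ?exprn_ge0 ?(doubling_ge0 hU).
- exact: measurable_funTS.
- by move=> q; exact: measurable_funTS.
- move=> y [_ /= tF]; have [F0|[q [qS qy Fv]]] := finite_maximalP v (fun q => V q) S y.
    by move: tF; rewrite F0 ltNge t_ge0.
  have [||q' q'S' qq'] := SQ q => //; first by rewrite -Fv.
  by exists q' => //; exact: hk Fv.
- move=> q /Qf fq; have kE : k (Q q) = k (Q q) \_ (V (Q q)).
    apply/funext => y; rewrite patchE; case: ifPn => // /negP yQ.
    by apply: kV => Qy; apply: yQ; exact: mem_set.
  apply: (@le_trans _ _ (\int[mu]_y k (Q q) y)); first exact: ge0_subset_integral.
  rewrite kE -integral_mkcond; apply: le_trans (kf _) _.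
  by rewrite -mulrA EFinM -muleA; apply: lee_wpmul2l.
Qed.

Lemma level_set_weight t : (t0 <= t)%R ->
  \int[mu]_(y in Om t) f y <= (D ^+ 4 * t)%:E * mu (Om t).
Proof.
move=> t0t; rewrite -[X in (X * t)%:E]mul1r.
apply: (level_selection_integral (k := fun q => f \_ (V q))) => //.
- move=> q; apply/(measurable_restrictT _ _).1; first exact: measurable_base hU _ _.
  exact: measurable_funTS.
- by move=> q y; apply: erestrict_ge0.
- move=> q; rewrite mul1e (eq_integral (f : borel G -> \bar R))// => y yq.
  by rewrite patchE yq.
- by move=> q y yq; rewrite patchE memNset.
- by move=> q q' y _ qy qq' _; rewrite patchE mem_set//; exact: qq'.
Qed.

Context (A : R).
Hypothesis A_ge1 : (1 <= A)%R.
Hypothesis hA : forall q,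
  \int[mu]_(y in (V q : set (borel G))) maximal mu U (f \_ (V q)) y <=
  A%:E * \int[mu]_(y in (V q : set (borel G))) f y.

Let A_ge0 : (0 <= A)%R := le_trans ler01 A_ge1.

(* Measurable minorants of the maximal functions are used throughout, since an
   uncountable supremum need not be measurable. *)
Lemma finite_maximal_integral q (S' : seq (G * int)) :
  (forall q', q' \in S' -> V q' `<=` V q) ->
  \int[mu]_(y in (V q : set (borel G))) (finite_maximal v (fun q => V q) S' y)%:E <=
  A%:E * \int[mu]_(y in (V q : set (borel G))) f y.
Proof.
move=> S'q; apply: le_trans (hA q); apply: ge0_le_lower_integral => y _.
  by rewrite lee_fin finite_maximal_ge0.
have [->|[q' [q'S q'y ->]]] := finite_maximalP v (fun q => V q) S' y.
  exact: maximal_ge0.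
by apply: base_average_le_maximal => //; exact: S'q.
Qed.

(** Localization: the set attaining [F y] lies in a dilate, so [F y] is at most the maximal function
    over the members of [S] inside that dilate, whose integral [hA] controls. *)
Lemma level_set_maximal t : (t0 <= t)%R ->
  \int[mu]_(y in Om t) (F y)%:E <= (A * D ^+ 4 * t)%:E * mu (Om t).
Proof.
move=> t0t.
pose S_ q := [seq q' <- S | `[< V q' `<=` V q >]].
have S_P q q' : q' \in S_ q -> V q' `<=` V q.
  by rewrite mem_filter => /andP[/asboolP].
apply: (level_selection_integral
  (k := fun q y => (finite_maximal v (fun q => V q) (S_ q) y)%:E)) => //.
- exact/measurable_EFinP.
- by move=> y; rewrite lee_fin finite_maximal_ge0.
- move=> q; apply/measurable_EFinP; apply: measurable_finite_maximal => q'.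
  exact: measurable_base hU _ _.
- by move=> q y; rewrite lee_fin finite_maximal_ge0.
- by move=> q; apply: finite_maximal_integral; exact: S_P.
- move=> q y qy; have [->//|[q' [/S_P q'q /q'q//]]] :=
    finite_maximalP v (fun q => V q) (S_ q) y.
- move=> q q' y qS qy qq' ->; rewrite lee_fin.
  apply: (finite_maximal_ge v (V := fun q => V q)) => //.
  by rewrite mem_filter qS andbT; exact/asboolP.
Qed.

(** The layer-cake estimate is used twice: with [h] equal to [F] it bounds the integral of F^(1+e)
    by absorption, then with [h] equal to [f] it gives the claim. The factor [A] of the first bound
    is compensated by the small coefficient in the second. *)
Lemma finite_maximal_reverse_holder e : (0 < e)%R ->
  (A * D ^+ 4 * (e / (1 + e)) <= 4^-1)%R ->
  \int[mu]_(y in (Bh : set (borel G))) (f y * (F y `^ e)%:E) <=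
  (2 * t0 `^ (1 + e))%:E * mu Bh.
Proof.
move=> e0 he; have e10 : (0 < 1 + e)%R by rewrite addr_gt0.
have t00 : (0 <= t0)%R := base_average_ge0 _.
have D40 : (0 <= D ^+ 4)%R by rewrite exprn_ge0// (doubling_ge0 hU).
have mBh : measurable (Bh : set (borel G)) by exact: measurable_base hU _ _.
pose L := sort <=%R (undup [seq t <- [seq v q | q <- S] | (t0 < t)%R]).
have mem_L t : t \in L = (t0 < t)%R && (t \in [seq v q | q <- S]).
  by rewrite mem_sort mem_undup mem_filter.
have pL : path <%R t0 L.
  rewrite path_min_sorted; last by apply/allP => t; rewrite mem_L => /andP[].
  by rewrite sort_lt_sorted undup_uniq.
have FL y : (F y <= t0)%R || (F y \in L).
  have [->|[q [qS qy ->]]] := finite_maximalP v (fun q => V q) S y; first by rewrite t00.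
  by rewrite mem_L; case: leP => //= _; exact: map_f.
have F_ge0 y : (0 <= F y)%R by exact: finite_maximal_ge0.
have mFs s : measurable_fun setT (fun y : borel G => (F y `^ s)%:E).
  by apply/measurable_EFinP; exact: (measurableT_comp (measurable_powR _)).
pose I := \int[mu]_(y in (Bh : set (borel G))) (F y `^ (1 + e))%:E.
have I0 : 0 <= I by apply: integral_ge0 => y _; rewrite lee_fin powR_ge0.
have mBf := base_fin_num (x0, theta i).
(* Absorption needs a finite integral; [F] is bounded by the largest average in [S]. *)
have Ify : I < +oo.
  pose M := \big[Num.max/0%R]_(q <- S) v q.
  have FM y : (F y <= M)%R.
    have [->|[q [qS qy ->]]] := finite_maximalP v (fun q => V q) S y.
      rewrite /M; elim: (S) => [|q S' IH]; rewrite ?big_nil// big_cons le_max IH orbT//.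
    exact: (@le_bigmax_seq _ _ _ S 0%R q xpredT v qS isT).
  apply: (@le_lt_trans _ _ (\int[mu]_(y in (Bh : set (borel G))) cst (M `^ (1 + e))%:E y)).
    apply: ge0_le_integral => //.
    - by move=> y _; rewrite lee_fin powR_ge0.
    - exact: measurable_funTS.
    - move=> y _; rewrite lee_fin ge0_ler_powR ?nnegrE ?FM// ?(ltW e10)//.
      exact: le_trans (F_ge0 y) (FM y).
  rewrite integral_cst// lte_mul_pinfty// ?lee_fin ?powR_ge0//.
  exact: base_lty hG mu_fin hU _ _.
set m := fine (mu Bh).
have mE : mu Bh = m%:E by rewrite fineK.
have fE : \int[mu]_(y in (Bh : set (borel G))) f y = (t0 * m)%:E.
  by rewrite (base_averageE (x0, theta i)) (EFinM t0 m) -mE.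
have FE : \int[mu]_(y in (Bh : set (borel G))) (F y)%:E <= (A * (t0 * m))%:E.
  rewrite (EFinM A) -fE; apply: (@finite_maximal_integral (x0, theta i)).
  by move=> q /S_closed[qx0 qi _]; exact: (translate_sub hU symU qi qx0).
have m0 : (0 <= m)%R by rewrite fine_ge0.
have tt : (t0 `^ e * t0 = t0 `^ (1 + e))%R.
  by rewrite mulrC -(mulr_powRB1 t00 e10) addrAC subrr add0r.
have h1 : I <= (t0 `^ e)%:E * (A * (t0 * m))%:E + (A * D ^+ 4 * (e / (1 + e)))%:E * I.
  have IE : I = \int[mu]_(y in (Bh : set (borel G))) ((F y)%:E * (F y `^ e)%:E).
    apply: eq_integral => y _; rewrite -EFinM -(mulr_powRB1 (F_ge0 y) e10).
    by rewrite addrAC subrr add0r.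
  apply: (@le_trans _ _ ((t0 `^ e)%:E * \int[mu]_(y in (Bh : set (borel G))) (F y)%:E +
      (A * D ^+ 4 * (e / (1 + e)))%:E * I)); last first.
    by apply: leeD; [apply: lee_wpmul2l; rewrite ?lee_fin ?powR_ge0|exact: lexx].
  rewrite {1}IE.
  apply: (@integral_mul_powR_le _ _ _ mu (Bh : set (borel G)) (fun y => (F y)%:E) F L
    t0 (A * D ^+ 4)%R e) => //.
  - exact/measurable_EFinP.
  - by rewrite mulr_ge0.
  - exact: level_set_maximal.
have h2 : \int[mu]_(y in (Bh : set (borel G))) (f y * (F y `^ e)%:E) <=
    (t0 `^ e)%:E * (t0 * m)%:E + (D ^+ 4 * (e / (1 + e)))%:E * I.
  rewrite -fE; apply: (@integral_mul_powR_le _ _ _ mu (Bh : set (borel G)) f F L) => //.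
  exact: level_set_weight.
apply: (le_trans h2); rewrite mE -(@fineK _ I) ?ge0_fin_numE//.
move: h1; rewrite -(@fineK _ I) ?ge0_fin_numE// -!EFinM -!EFinD !lee_fin.
have fI : (0 <= fine I)%R by rewrite fine_ge0.
move: (fine I) fI => r r0.
have -> : (t0 `^ e * (A * (t0 * m)) = A * (t0 `^ (1 + e) * m))%R.
  by rewrite -tt; ring.
have -> : (t0 `^ e * (t0 * m) = t0 `^ (1 + e) * m)%R by rewrite mulrA tt.
rewrite -[(2 * _ * m)%R]mulrA /=.
set z := (t0 `^ (1 + e) * m)%R; have z0 : (0 <= z)%R by rewrite mulr_ge0// powR_ge0.
move: he; rewrite -mulrA; set k := (D ^+ 4 * _)%R => he hr.
have k0 : (0 <= k)%R by rewrite mulr_ge0// divr_ge0// ltW.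
(* Since A k <= 1/4, r <= A z + r/4 yields this bound; then k r <= 2 A k z <= z/2, and z + k r <= 2
   z. *)
have r2 : (r <= 2 * (A * z))%R.
  have : (A * k * r <= 4^-1 * r)%R by rewrite ler_wpM2r.
  lra.
have : (k * r <= k * (2 * (A * z)))%R by rewrite ler_wpM2l.
have : (A * k * z <= 4^-1 * z)%R by rewrite ler_wpM2r.
lra.
Qed.

End finite_subfamily.
End reverse_holder.

(** * A weak differentiation theorem along countable nets *)

Section differentiation.
Context {R : realType} {G : topologicalZmodType} (mu : {measure set (borel G) -> \bar R}).
Context (U : int -> set G) (D : R) (theta : int -> int).
Hypotheses (hG : hausdorff_space G) (mu_fin : finite_on_compacts mu).
Hypotheses (hU : covering_family mu U D theta) (symU : symmetric_family U).

Local Notation T x n := (translate x (U n)).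
Local Notation V q := (translate q.1 (U q.2)).

(** The closure of [T x i] is compact, and the interiors of the sets [T y n] with [y] in [T x i]
    cover it. *)
Lemma finite_net x i n : exists2 X : seq G, (forall y, y \in X -> T x i y) &
  forall z, T x i z -> exists2 y, y \in X & T y n z.
Proof.
have [K cK TK] := base_compact hU x i.
pose pG : ptopologicalType :=
  HB.pack (Topological.sort G) (isPointed.Build (Topological.sort G) (0%R : G)).
have cT : compact (closure (T x i) : set pG).
  apply: (subclosed_compact _ cK); first exact: closed_closure.
  by rewrite closureE; apply: smallest_sub TK; exact: compact_closed.
rewrite compact_cover in cT.
have [||X XT Xcov] := cT G (T x i) (fun y => (interior (T y n) : set pG)).
- by move=> y _; exact: open_interior.
(* A point [z] of the closure need not be an admissible centre; its neighbourhood [O] meets [T x i]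
   in one. *)
- move=> z zT; pose O := [set y | interior (U n) (z - y)%R].
  have : nbhs z O.
    apply: (@subl_continuous G z z); rewrite subrr; apply: open_nbhs_nbhs; split.
      exact: open_interior.
    exact: (cf_nbhs hU n).
  move=> /zT[y [yT yO]]; exists y => //.
  have : nbhs z ((fun z => z - y)%R @^-1` U n) by apply: (@subr_continuous _ y z).
  by rewrite /= -translate_preimage.
exists (finmap.enum_fset X).
  by move=> y /XT; rewrite inE.
by move=> z /subset_closure/Xcov[y /= yX /interior_subset]; exists y.
Qed.

(** A point in infinitely many [N k] is a limit of points of [K], as the sets [U (i - k)] shrink to
    0; hence it is in [K]. The bound passes to the limit by continuity from above, the measures
    being finite inside [T x0 n0]. *)
Lemma measure_shrinking (K : set G) (N : nat -> set G) x0 n0 i (c : \bar R) k0 :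
  compact K -> (forall k, measurable (N k : set (borel G))) ->
  (forall k, N k `<=` T x0 n0) ->
  (forall k y, N k y -> exists z a b,
    [/\ K z, U (i - k%:Z)%R a, U (i - k%:Z)%R b & y = (z + (a - b))%R]) ->
  (forall k, (k0 <= k)%N -> c <= mu (N k)) -> c <= mu K.
Proof.
move=> cK mN NT NK cN.
(* The [N k] are not nested; their tail unions are. *)
pose W k : set (borel G) := \bigcup_(l in [set l | (k <= l)%N]) N l.
have mW k : measurable (W k) by exact: bigcup_measurable.
have mWI : measurable (\bigcap_k W k) by exact: bigcapT_measurable.
have WT k : W k `<=` T x0 n0 by apply: bigcup_sub => l _; exact: NT.
have W0 : mu (W 0%N) < +oo.
  apply: le_lt_trans (base_lty hG mu_fin hU x0 n0).
  by apply: le_measure; rewrite ?inE//; exact: measurable_base hU _ _.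
have Wni : {homo W : n m / (n <= m)%N >-> (m <= n)%O}.
  move=> n m nm; apply/subsetPset => y [l /= ml Ny].
  by exists l => //=; exact: leq_trans nm ml.
have WK : \bigcap_k W k `<=` K.
  move=> y Wy; rewrite (closure_id K).1; last exact: compact_closed.
  move=> O yO.
  have : nbhs ((0%R : G) - 0)%R ((fun z => y - z)%R @^-1` O).
    by rewrite subr0; apply: (@subl_continuous G y 0%R); rewrite subr0.
  move=> /(@sub_continuous G (0, 0)%R)[[A B] /= [A0 B0] AB].
  have [n nAB] := cf_base hU (filterI A0 B0).
  have [l /= nl Nl] := Wy `|i - n|%N I.
  have [z [a [b [Kz Ua Ub yE]]]] := NK _ _ Nl.
  have ln : (i - l%:Z <= n)%R by lia.
  exists z; split => //.
  have -> : z = (y - (a - b))%R by rewrite yE addrK.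
  by apply: (AB (a, b)); split => /=; [have [] := nAB _ (covering_le hU ln Ua)|
    have [] := nAB _ (covering_le hU ln Ub)].
apply: (@le_trans _ _ (mu (\bigcap_k W k))); last first.
  apply: le_measure; rewrite ?inE//; exact: measurable_compact.
have cvW := nonincreasing_cvg_mu W0 mW mWI Wni.
rewrite -(cvg_lim _ cvW)//; apply: lime_ge; first by apply/cvg_ex; eexists; exact: cvW.
exists k0 => // k /= k0k; apply: le_trans (cN k k0k) _.
by apply: le_measure; rewrite ?inE // => y Ny; exists k => //=.
Qed.

Hypothesis mu_reg : inner_regular mu.
Hypothesis mu_gt0 : forall x n, 0 < mu (T x n).
Context (f : G -> \bar R).
Hypotheses (mf : measurable_fun setT (f : borel G -> \bar R)) (f0 : forall y, 0 <= f y).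
Hypothesis f_lty : forall x n, \int[mu]_(y in (T x n : set (borel G))) f y < +oo.

Local Notation v := (base_average mu U f).
Local Notation vE := (base_averageE hG mu_fin hU mu_gt0 f0 f_lty).

Context (x0 : G) (i : int) (X : nat -> seq G).
Hypothesis X_sub : forall k y, y \in X k -> T x0 i y.
Hypothesis X_net : forall k z, T x0 i z -> exists2 y, y \in X k & T y (i - k%:Z)%R z.

(** The centres come from the nets 0 to [N], the scales run from [i] down to [i - N]. This product
    form makes the family closed under raising the scale up to [i], and increasing in [N]. *)
Definition net_family (N : nat) : seq (G * int) :=
  [seq (x, (i - k%:Z)%R) | x <- flatten [seq X l | l <- iota 0 N.+1], k <- iota 0 N.+1].

Lemma net_familyP N q : reflect
  (exists l k, [/\ (l <= N)%N, (k <= N)%N, q.1 \in X l & q.2 = (i - k%:Z)%R])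
  (q \in net_family N).
Proof.
apply: (iffP allpairsP) => [[[x k] [xX kN ->]]|[l [k [lN kN qX qk]]]].
  move: kN; rewrite mem_iota add0n ltnS => /andP[_ kN].
  have /flattenP[_ /mapP[l lN ->] xl] := xX.
  by exists l, k; split => //; rewrite mem_iota add0n ltnS in lN; case/andP: lN.
exists (q.1, k); split.
- apply/flattenP; exists (X l) => //; apply: map_f.
  by rewrite mem_iota add0n ltnS.
- by rewrite mem_iota add0n ltnS.
- by rewrite -qk; case: (q).
Qed.

Lemma net_family_closed N q : q \in net_family N -> [/\ T x0 i q.1, (q.2 <= i)%R &
  forall n, (q.2 <= n <= i)%R -> (q.1, n) \in net_family N].
Proof.
move=> /net_familyP[l [k [lN kN qX ->]]]; split.
- exact: X_sub qX.
- lia.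
- move=> n ni; apply/net_familyP; exists l, `|i - n|%N; split => //=; lia.
Qed.

Lemma net_family_sub M N : (M <= N)%N -> {subset net_family M <= net_family N}.
Proof.
move=> MN q /net_familyP[l [k [lM kM qX qk]]]; apply/net_familyP; exists l, k.
by split => //; exact: leq_trans MN.
Qed.

Local Notation F N := (finite_maximal v (fun q => V q) (net_family N)).

Lemma net_average_le (a : R) k l x y : (forall N, F N y <= a)%R -> x \in X l ->
  T x (i - k%:Z)%R y -> (v (x, (i - k%:Z)%R) <= a)%R.
Proof.
move=> Fa xX xy; apply: le_trans (Fa (maxn k l)).
apply: (finite_maximal_ge v (V := fun q => V q)) => //.
by apply/net_familyP; exists l, k; rewrite leq_maxr leq_maxl.
Qed.

(* Any constant in ]1, 2[ could replace [3 / 2]. *)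
Definition low_maximal_set (a : R) : set (borel G) := T x0 i `&`
  [set y | (3 / 2 * D ^+ 2 * a)%:E < f y] `&` \bigcap_N [set y | (F N y <= a)%R].

Lemma measurable_low_maximal_set a : measurable (low_maximal_set a).
Proof.
apply: measurableI.
  apply: emeasurable_fun_o_infty; first exact: measurable_base hU _ _.
  exact: measurable_funTS.
apply: bigcapT_measurable => N.
rewrite (_ : [set y | _] = (F N : borel G -> R) @^-1` `]-oo, a]%classic).
  rewrite -[X in measurable X]setTI; apply: measurable_finite_maximal => //.
  by move=> q; exact: measurable_base hU _ _.
by apply/seteqP; split => y; rewrite /= in_itv.
Qed.

Let D_gt0 : (0 < D)%R. Proof. exact: lt_le_trans (cf_doubling_ge1 hU). Qed.

(** On [K] the function exceeds (3/2) D^2 a, whereas all averages over net sets meeting [K] are at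
    most [a]. A Vitali selection among small net sets bounds the integral of [f] over [K] by D^2 a
    times the measure of their union, which shrinks to [K]. *)
Lemma compact_low_maximal_set a (K : set (borel G)) : (0 < a)%R -> compact (K : set G) ->
  K `<=` low_maximal_set a -> mu K = 0.
Proof.
move=> a0 cK KE.
have mK : measurable K := measurable_compact hG cK.
have Kf : forall (L : set (borel G)), measurable L -> L `<=` K ->
    (3 / 2 * D ^+ 2 * a)%:E * mu L <= \int[mu]_(y in L) f y.
  move=> L mL LK; rewrite -integral_cst//; apply: ge0_le_integral => //.
  - by move=> y _; rewrite lee_fin !mulr_ge0// ?exprn_ge0// ltW.
  - exact: measurable_funTS.
  - by move=> y /LK/KE[[_ /ltW]].
have Kfin (L : set (borel G)) : measurable L -> L `<=` K -> mu L \is a fin_num.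
  move=> mL LK; rewrite ge0_fin_numE//.
  by apply: le_lt_trans (mu_fin cK); apply: le_measure; rewrite ?inE.
(* As [N k] shrinks to [L], the hypotheses give [3 / 2 * mu L <= mu L]. *)
have small (L : set (borel G)) (N : nat -> set G) k0 : compact (L : set G) -> L `<=` K ->
    (forall k, measurable (N k : set (borel G))) -> (forall k, N k `<=` T x0 (theta i)) ->
    (forall k y, N k y -> exists z a b,
      [/\ L z, U (i - k%:Z)%R a, U (i - k%:Z)%R b & y = (z + (a - b))%R]) ->
    (forall k, (k0 <= k)%N ->
      \int[mu]_(y in L) f y <= (D ^+ 2 * a)%:E * mu (N k : set (borel G))) ->
    mu L = 0.
  move=> cL LK mN NT NL fN.
  have mL : measurable L := measurable_compact hG cL.
  have : (3 / 2)%:E * mu L <= mu L.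
    apply: (measure_shrinking (k0 := k0) cL mN NT NL) => k k0k.
    have D2a : (0 < D ^+ 2 * a)%R by rewrite mulr_gt0// exprn_gt0.
    rewrite -(@lee_pmul2l _ (D ^+ 2 * a)%:E)// muleA -EFinM.
    apply: le_trans (fN k k0k); apply: le_trans (Kf L mL LK).
    by have -> : (D ^+ 2 * a * (3 / 2) = 3 / 2 * D ^+ 2 * a)%R by ring.
  rewrite -(fineK (Kfin L mL LK)) -EFinM lee_fin => h.
  have := fine_ge0 (measure_ge0 mu L); move: (fine _) h => r h r0.
  by congr (_%:E); lra.
have e (W : zmodType) (u s t : W) : u = (s + (u - t - (s - t)))%R.
  by rewrite opprB subrKA addrC subrK.
(* If one double dilate has scale at most [i], so have those of all smaller scales, and they can be
   compared with net sets of the same centre and scale. *)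
have [[n1 n1i]|noscale] := pselect (exists n, (theta (theta n) <= i)%R).
  pose S k := [seq q <- [seq (x, (i - k%:Z)%R) | x <- X k] | `[< V q `&` K !=set0 >]].
  have SP k q : q \in S k -> [/\ q.1 \in X k, q.2 = (i - k%:Z)%R & V q `&` K !=set0].
    by rewrite mem_filter => /andP[/asboolP + /mapP[x xX qE]]; rewrite qE.
  have ST k q : q \in S k -> V q `<=` T x0 (theta i).
    move=> /SP[/X_sub qx0 -> _]; apply: (translate_sub hU symU _ qx0); lia.
  pose N k : set (borel G) := \big[setU/set0]_(q <- S k) V q.
  have NP k y : N k y <-> exists2 q, q \in S k & V q y.
    by rewrite /N -bigcup_seq; split => -[q qS qy]; exists q.
  have mN k : measurable (N k).
    by apply: bigsetU_measurable => q _; exact: measurable_base hU _ _.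
  have KN k : K `<=` N k.
    move=> y Ky; have [[x0y _] _] := KE y Ky.
    have [x xX xy] := X_net k x0y; apply/NP; exists (x, (i - k%:Z)%R) => //.
    rewrite mem_filter; apply/andP; split; [by apply/asboolP; exists y|].
    by apply/mapP; exists x.
  apply: (small K N `|i - n1|%N cK (@subset_refl _ _) mN).
  - by move=> k y /NP[q qS qy]; exact: (ST k q qS).
  - move=> k y /NP[q /SP[_ qk [z [qz Kz]]] qy].
    move: qz qy => /translateE; rewrite qk => qz /translateE qy.
    exists z, (y - q.1)%R, (z - q.1)%R; split => //.
  move=> k kk0; have thi : (theta (theta (i - k%:Z)) <= i)%R.
    apply: le_trans n1i; apply: (cf_theta_increasing hU); apply: (cf_theta_increasing hU); lia.
  have [|S' [uS' S'S tS' S'max]] := @vitali_selection _ _ (fun q => V q) snd (S k).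
    by move=> q; exists q.1; exact: translate_center hU _ _.
  pose Q q := (q.1, theta (theta q.2)) : G * int.
  (* Cutting [f] to [K] moves the integral to [N k], the union of the sets subject to selection. *)
  have -> : \int[mu]_(y in K) f y = \int[mu]_(y in N k) (f \_ K) y.
    by rewrite -integral_mkcondr (setIidr (KN k)).
  apply: (@integral_le_sum_selection _ _ _ mu _ (fun q => V q : set (borel G)) _ S' _ _
    (fun q => f \_ (V (Q q)))) => //.
  - by move=> q; exact: measurable_base hU _ _.
  - by move=> q /S'S qS y qy; apply/NP; exists q.
  - by rewrite lee_fin mulr_ge0 ?exprn_ge0// ltW.
  - apply: measurable_funTS; apply/(measurable_restrictT _ _).1 => //.
    exact: measurable_funTS.
  - by move=> y _; exact: erestrict_ge0.
  - move=> q; apply: measurable_funTS; apply/(measurable_restrictT _ _).1.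
      exact: measurable_base hU _ _.
    exact: measurable_funTS.
  - by move=> q y _; exact: erestrict_ge0.
  - move=> y /NP[q qS qy]; have [q' [q'S' qq' ne]] := S'max q qS.
    exists q' => //; rewrite (patchE f (V (Q q'))) mem_set; last first.
      exact: (translate_meet hU symU qq' ne).
    by rewrite patchE; case: ifPn.
  move=> q /S'S /SP[qX qk [y [qy Ky]]].
  apply: (@le_trans _ _ (\int[mu]_y (f \_ (V (Q q))) y)).
    apply: ge0_subset_integral => //.
    - apply/(measurable_restrictT _ _).1; first exact: measurable_base hU _ _.
      exact: measurable_funTS.
    - by move=> z _; exact: erestrict_ge0.
  (* The double dilate is itself a net set and contains the point [y] of [K], so its average is at
     most [a]. *)
  have qQ : (Q q).2 = (i - `|i - (Q q).2|%N%:Z)%R by rewrite /Q /= qk; lia.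
  rewrite -integral_mkcond vE (mulrC (D ^+ 2)%R) (EFinM a) -muleA.
  apply: lee_pmul => //; [|rewrite lee_fin|exact: (base_doubling hU 2)].
    by rewrite lee_fin base_average_ge0.
  rewrite (surjective_pairing (Q q)) qQ; apply: (@net_average_le _ `|i - (Q q).2|%N k _ y) => //.
    by move=> N'; have [_ /(_ N' I)] := KE y Ky.
  rewrite -qQ; apply: (translate_le hU) qy.
  exact: le_trans (cf_theta_ge hU _) (cf_theta_ge hU _).
(* All scales being comparable to [i], every point of [T x0 i] is an atom, and the
   point [y] alone can play the role of [K]. *)
have [->|/set0P[y Ky]] := eqVneq K set0; first by rewrite measure0.
have [[x0y _] Fy] := KE y Ky.
have [x xX] : {x : nat -> G & forall k, x k \in X k /\ T (x k) (i - k%:Z)%R y}.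
  apply: (@choice nat G (fun k z => z \in X k /\ T z (i - k%:Z)%R y)) => k.
  by have [z] := X_net k x0y; exists z.
pose N k : set (borel G) := T (x k) (i - k%:Z)%R.
have Nx0 k : T x0 i (x k) by apply: (@X_sub k); have [] := xX k.
have yK : [set y] `<=` K by move=> _ ->.
have cy : compact [set (y : G)] by exact: compact_set1.
have NT k : N k `<=` T x0 (theta i) by apply: (translate_sub hU symU _ (Nx0 k)); lia.
have NL k z : N k z -> exists z0 a b,
    [/\ [set y] z0, U (i - k%:Z)%R a, U (i - k%:Z)%R b & z = (z0 + (a - b))%R].
  move=> /translateE zk; exists y, (z - x k)%R, (y - x k)%R; split => //.
    by apply/translateE; have [] := xX k.
  exact: (e G).
have mN k : measurable (N k) by exact: measurable_base hU _ _.
have y0 : mu [set y : borel G] = 0.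
  apply: (small _ N 0%N cy yK) => // k _.
  apply: (@le_trans _ _ (\int[mu]_(y in N k) f y)).
    apply: ge0_subset_integral => //.
    - exact: measurable_compact.
    - exact: measurable_funTS.
    - by move=> _ ->; have [] := xX k.
  rewrite (vE (x k, _)); apply: lee_wpmul2r => //.
  rewrite lee_fin; apply: (@le_trans _ _ a).
    by have [xk xy] := xX k; apply: net_average_le xk xy => N'; exact: Fy.
  by rewrite ler_peMl ?(ltW a0)// exprn_ege1// (cf_doubling_ge1 hU).
(* Contradiction: [i] is below [theta (theta (i - k))], so [T y i] lies in the triple dilate of
   [N k]. Thus [mu (N k)] stays above D^-3 mu(T y i) while [N k] shrinks to the null point [y]. *)
have : mu (T y i) * (D ^- 3)%:E <= 0.
  rewrite -y0; apply: (measure_shrinking cy mN NT NL (k0 := 0%N)) => k _.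
  rewrite muleC -(@lee_pmul2l _ (D ^+ 3)%:E)// ?lte_fin ?exprn_gt0//.
  rewrite muleA -EFinM divff ?gt_eqF ?exprn_gt0// mul1e.
  apply: (base_le_doubling hU); first exact: measurable_base hU _ _.
  apply: (@subset_trans _ (T (x k) (theta i))).
    apply: (translate_sub hU symU) => //.
    by have [_ ] := xX k; apply: (translate_le hU); lia.
  apply: (translate_le hU); apply: (cf_theta_increasing hU).
  by apply/ltW; rewrite ltNge; apply/negP => h; apply: noscale; exists (i - k%:Z)%R.
by rewrite leNgt mule_gt0// lte_fin invr_gt0 exprn_gt0.
Qed.

(** Inner regularity reduces this to compact subsets. *)
Lemma low_maximal_set_null a : (0 < a)%R -> mu (low_maximal_set a) = 0.
Proof.
move=> a0; rewrite mu_reg; last exact: measurable_low_maximal_set.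
apply/eqP; rewrite eq_le; apply/andP; split.
  by apply: ub_ereal_sup => _ [K [cK KE] <-]; rewrite (compact_low_maximal_set a0 cK KE).
by apply: ereal_sup_ubound; exists set0; rewrite ?measure0//; split => //; exact: compact0.
Qed.

End differentiation.

(** * Passage from finite families to the reverse Hoelder inequality *)

Section reverse_holder_inequality.
Context {R : realType} {G : topologicalZmodType} (mu : {measure set (borel G) -> \bar R}).
Context (U : int -> set G) (D : R) (theta : int -> int).
Hypotheses (hG : hausdorff_space G) (mu_reg : inner_regular mu) (mu_fin : finite_on_compacts mu).
Hypotheses (hU : covering_family mu U D theta) (symU : symmetric_family U).
Hypothesis theta_lt : forall i, (i < theta i)%R.

Local Notation T x n := (translate x (U n)).
Local Notation V q := (translate q.1 (U q.2)).

Hypothesis mu_gt0 : forall x n, 0 < mu (T x n).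
Context (f : G -> \bar R).
Hypotheses (mf : measurable_fun setT (f : borel G -> \bar R)) (f0 : forall y, 0 <= f y).
Hypothesis f_lty : forall x n, \int[mu]_(y in (T x n : set (borel G))) f y < +oo.
Local Notation v := (base_average mu U f).

Context (A : R).
Hypothesis A_ge1 : (1 <= A)%R.
Hypothesis hA : forall q,
  \int[mu]_(y in (V q : set (borel G))) maximal mu U (f \_ (V q)) y <=
  A%:E * \int[mu]_(y in (V q : set (borel G))) f y.

(** Monotone convergence along the net families. Almost everywhere on [T x0 i] the limit of [F N] is
    at least f/(2 D^2), so f^(1+e) is at most (2 D^2)^e times the limit of [g N]. *)
Lemma reverse_holder x0 i e : (0 < e)%R -> (A * D ^+ 4 * (e / (1 + e)) <= 4^-1)%R ->
  \int[mu]_(y in (T x0 i : set (borel G))) (f y `^ (1 + e)) <=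
  ((2 * D ^+ 2) `^ e * (2 * v (x0, theta i) `^ (1 + e)))%:E * mu (T x0 (theta i)).
Proof.
move=> e0 he; have e10 : (0 < 1 + e)%R by rewrite addr_gt0.
have D_gt0 : (0 < D)%R := lt_le_trans ltr01 (cf_doubling_ge1 hU).
have [X hX] : {X : nat -> seq G & forall k, (forall y, y \in X k -> T x0 i y) /\
    forall z, T x0 i z -> exists2 y, y \in X k & T y (i - k%:Z)%R z}.
  apply: (@choice nat (seq G) (fun k Xk => (forall y, y \in Xk -> T x0 i y) /\
    forall z, T x0 i z -> exists2 y, y \in Xk & T y (i - k%:Z)%R z)) => k.
  by have [Xk] := finite_net hG hU x0 i (i - k%:Z)%R; exists Xk.
have X_sub k : forall y, y \in X k -> T x0 i y by have [] := hX k.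
have X_net k : forall z, T x0 i z -> exists2 y, y \in X k & T y (i - k%:Z)%R z.
  by have [] := hX k.
pose F N := finite_maximal v (fun q => V q) (net_family i X N).
pose g N y := f y * (F N y `^ e)%:E.
pose B : set (borel G) := T x0 i.
have mB : measurable B by exact: measurable_base hU _ _.
have F_ge0 N y : (0 <= F N y)%R by exact: finite_maximal_ge0.
have mg N : measurable_fun setT (g N : borel G -> \bar R).
  apply: emeasurable_funM => //; apply/measurable_EFinP.
  apply: (measurableT_comp (measurable_powR _)).
  by apply: measurable_finite_maximal => q; exact: measurable_base hU _ _.
have g0 N y : 0 <= g N y by rewrite mule_ge0// lee_fin powR_ge0.
have gnd y : {homo (g ^~ y) : m n / (m <= n)%N >-> m <= n}.
  move=> m n mn; apply: lee_wpmul2l => //; rewrite lee_fin.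
  by rewrite ge0_ler_powR ?nnegrE ?(ltW e0)//; apply: finite_maximal_sub; exact: net_family_sub.
have gcv y : g ^~ y @ \oo --> ereal_sup (range (g ^~ y)) := ereal_nondecreasing_cvgn (gnd y).
have glim N y : g N y <= limn (g ^~ y).
  by rewrite (cvg_lim _ (gcv y))//; apply: ereal_sup_ubound; exists N.
have lim0 y : 0 <= limn (g ^~ y) by exact: le_trans (g0 0%N y) (glim _ _).
have mlim : measurable_fun B (fun y => limn (g ^~ y)).
  rewrite (_ : (fun _ => _) = fun y => limn_esup (g ^~ y)); last first.
    by apply/funext => y; rewrite is_cvg_limn_esupE//; apply/cvg_ex; eexists; exact: gcv.
  by apply: measurable_fun_limn_esup => N; exact: measurable_funTS.
have intlim : \int[mu]_(y in B) limn (g ^~ y) <=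
    (2 * v (x0, theta i) `^ (1 + e))%:E * mu (T x0 (theta i)).
  have cvI := @cvg_monotone_convergence _ _ _ mu _ mB g (fun N => measurable_funTS (mg N))
    (fun N y _ => g0 N y) (fun y _ => gnd y).
  rewrite -(cvg_lim _ cvI)//; apply: lime_le; first by apply/cvg_ex; eexists; exact: cvI.
  exists 0%N => // N _ /=.
  apply: (@le_trans _ _ (\int[mu]_(y in (T x0 (theta i) : set (borel G))) g N y)).
    apply: ge0_subset_integral => //; first exact: measurable_base hU _ _.
      exact: measurable_funTS.
    exact: (translate_theta hU).
  apply: (finite_maximal_reverse_holder hG mu_fin hU symU theta_lt mu_gt0 mf f0 f_lty
    _ A_ge1 hA) => // q; exact: net_family_closed.
(* [a] enumerates the rationals, so that the exceptional set is a countable union; the default 1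
   only repeats a value. *)
pose a n : R := if unpickle n is Some q then ratr (q : rat) else 1%R.
pose Z n : set (borel G) :=
  if (0 < a n)%R then low_maximal_set mu U D f x0 i X (a n) else set0.
have Z0 : mu.-negligible (\bigcup_n Z n).
  apply: negligible_bigcup => n; rewrite /Z; case: ifPn => [an0|_]; last exact: negligible_set0.
  apply/negligibleP; first exact: (measurable_low_maximal_set hU mf).
  exact: (low_maximal_set_null hG mu_fin hU symU mu_reg).
have large y (q : rat) : B y -> ~ (\bigcup_n Z n) y -> (0 < ratr q :> R)%R ->
    (3 / 2 * D ^+ 2 * ratr q)%:E < f y -> exists N, (ratr q < F N y)%R.
  move=> By Zy q0 fq; apply: contrapT => /forallNP NF; apply: Zy.
  exists (pickle q) => //; rewrite /Z /a pickleK q0; split; first by split.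
  by move=> N _ /=; rewrite leNgt; apply/negP; exact: NF.
set c := ((2 * D ^+ 2) `^ e)%R.
have D20 : (0 < 2 * D ^+ 2)%R by rewrite mulr_gt0// exprn_gt0.
have c0 : (0 < c)%R by rewrite powR_gt0.
apply: (@le_trans _ _ (\int[mu]_(y in B) (c%:E * limn (g ^~ y)))); last first.
  rewrite ge0_integralZl// ?lee_fin ?(ltW c0)// (EFinM c) -muleA.
  by apply: lee_wpmul2l => //; rewrite lee_fin ltW.
apply: ae_ge0_le_integral => //.
- by move=> y _; rewrite poweR_ge0.
- apply: measurable_funTS.
  exact: (measurableT_comp (measurable_poweR _)).
- by move=> y _; rewrite mule_ge0// lee_fin ltW.
- exact: measurable_funeM.
apply: negligibleS Z0 => y /= /not_implyP[By]; apply: contra_notP => Zy.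
have := f0 y; case fy : (f y) => [r| |//]; last first.
  move=> _; rewrite poweRyr ?gt_eqF//.
  (* Where [f] is infinite, any positive value of [F N] makes [g N] infinite; the threshold 1 is
     arbitrary. *)
  have [||N FN] := large y 1%R By Zy; rewrite ?rmorph1 ?ltr01 ?fy ?ltry//.
  rewrite rmorph1 in FN.
  have : g N y = +oo.
    by rewrite /g fy gt0_mulye// lte_fin powR_gt0// (lt_trans ltr01).
  have := glim N y => /[swap] ->; rewrite leye_eq => /eqP ->.
  by rewrite gt0_muley// lte_fin.
rewrite lee_fin le_eqVlt => /predU1P[<-|r0].
  by rewrite poweR0r ?gt_eqF// mule_ge0// lee_fin ltW.
(* The gap between the constants 3/2 and 2 leaves room for a rational threshold. *)
have [q] : exists q : rat, ratr q \in `](r / (2 * D ^+ 2))%R, (r / (3 / 2 * D ^+ 2))%R[.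
  apply: rat_in_itvoo.
  rewrite ltr_pM2l// ltf_pV2 ?posrE ?mulr_gt0 ?exprn_gt0//.
  by rewrite ltr_pM2r ?exprn_gt0//; lra.
rewrite in_itv/= => /andP[rq qr].
have q0 : (0 < ratr q :> R)%R by apply: lt_trans rq; rewrite divr_gt0.
have [|N FN] := large y q By Zy q0.
  by rewrite fy lte_fin mulrC -ltr_pdivlMr// !mulr_gt0// exprn_gt0.
apply: (@le_trans _ _ (c%:E * g N y)); last by apply: lee_wpmul2l => //; rewrite lee_fin ltW.
rewrite /g fy -!EFinM lee_fin.
rewrite -(mulr_powRB1 (ltW r0) e10) addrAC subrr add0r mulrCA.
apply: ler_wpM2l; first exact: ltW.
rewrite /c -powRM ?(ltW D20) ?F_ge0//.
rewrite ge0_ler_powR ?nnegrE ?(ltW e0) ?(ltW r0)//.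
  by rewrite mulr_ge0// ltW.
by rewrite mulrC -ler_pdivrMr// ltW// (lt_trans rq).
Qed.

End reverse_holder_inequality.

(** * Inverses and vanishing integrals of nonnegative functions *)

Lemma measurable_ge0_inve d (T : measurableType d) (R : realType) (g : T -> \bar R) :
  (forall y, 0 <= g y) -> measurable_fun setT g ->
  measurable_fun setT (fun y => (g y)^-1).
Proof.
move=> g0 mg; apply: (measurability _ (ErealGenOInfty.measurableE R)) => // _ [_ [x ->] <-].
have [x0|x0] := ltP x 0%R.
  rewrite (_ : _ `&` _ = setT)// -subTset => y _; split => //=.
  by rewrite in_itv/= andbT (lt_le_trans _ (_ : 0 <= _))// ?lte_fin ?inve_ge0.
rewrite (_ : _ @^-1` _ = [set y | g y < x%:E^-1]); first exact: emeasurable_fun_infty_o.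
by apply/seteqP; split => y /=; rewrite in_itv/= andbT inve_pgt ?inE ?lee_fin.
Qed.

(** [f] vanishes almost everywhere on [E], so [g] is infinite almost everywhere on a set of positive
    measure. It will be applied to [w] and [sigma] in both orders. *)
Lemma integral_eq0_pinfty d (T : measurableType d) (R : realType)
    (mu : {measure set T -> \bar R}) (E : set T) (f g : T -> \bar R) :
  measurable E -> 0 < mu E -> measurable_fun setT f -> (forall y, 0 <= f y) ->
  measurable_fun setT g -> (forall y, 0 <= g y) -> (forall y, f y = 0 -> g y = +oo) ->
  \int[mu]_(y in E) f y = 0 -> \int[mu]_(y in E) g y = +oo.
Proof.
move=> mE E0 mf f0 mg g0 fg fE; have mfE : measurable_fun E f by exact: measurable_funTS.
have : \int[mu]_(y in E) `|f y| = 0.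
  by rewrite -fE; apply: eq_integral => y _; rewrite gee0_abs.
move=> /(ae_eq_integral_abs mu mE mfE) fae.
rewrite (@ge0_ae_eq_integral _ _ _ mu E g (cst +oo))//.
- by rewrite integral_cst// gt0_mulye.
- exact: measurable_funTS.
- by move=> y _; rewrite leey.
- by apply: filterS fae => y /= fy /fy; exact: fg.
Qed.

(** * Dual weights, degenerate cases and the A_p constant *)

Section Ap_weights.
Context {R : realType} {G : topologicalZmodType} (mu : {measure set (borel G) -> \bar R}).
Context (U : int -> set G) (D : R) (theta : int -> int).
Hypotheses (hG : hausdorff_space G) (mu_reg : inner_regular mu) (mu_fin : finite_on_compacts mu).
Hypotheses (hU : covering_family mu U D theta) (symU : symmetric_family U).
Hypothesis theta_lt : forall i, (i < theta i)%R.

Local Notation T x n := (translate x (U n)).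
Local Notation V q := (translate q.1 (U q.2)).

Lemma average_ge0 (g : G -> \bar R) (E : set G) : (forall y, 0 <= g y) -> 0 <= average mu g E.
Proof. by move=> g0; rewrite /average mule_ge0 ?inve_ge0// integral_ge0. Qed.

Context (p : R) (w : G -> \bar R).
Hypotheses (hp : (1 < p)%R) (hw : weight mu w).

Local Notation sigma := (dual_weight p w).

Let w0 : forall y, 0 <= w y. Proof. by have [] := hw. Qed.
Let mw : measurable_fun setT (w : borel G -> \bar R). Proof. by have [] := hw. Qed.

Lemma dual_weight_ge0 s y : 0 <= dual_weight s w y.
Proof. by rewrite inve_ge0 poweR_ge0. Qed.

Lemma measurable_dual_weight s : measurable_fun setT (dual_weight s w : borel G -> \bar R).
Proof.
apply: measurable_ge0_inve; first by move=> y; exact: poweR_ge0.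
exact: (measurableT_comp (measurable_poweR _)).
Qed.

Lemma conjugate_exponentB1 (s : R) : (1 < s)%R -> (conjugate_exponent s - 1 = (s - 1)^-1)%R.
Proof.
by move=> s1; rewrite /conjugate_exponent; field; rewrite subr_eq0 gt_eqF.
Qed.

(** For s = 1 + (p-1)/r one has s' - 1 = r/(p-1) = r (p' - 1). The values 0 and [+oo] are checked
    apart. *)
Lemma dual_weight_exponent (r : R) y : (1 < r)%R ->
  dual_weight (1 + (p - 1) / r)%R w y = sigma y `^ r.
Proof.
move=> r1; have r0 : r != 0%R by rewrite gt_eqF// (lt_trans ltr01).
have p10 : (0 < p - 1)%R by rewrite subr_gt0.
rewrite /dual_weight !conjugate_exponentB1//; last first.
  by rewrite ltrDl divr_gt0// (lt_trans ltr01).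
rewrite addrAC subrr add0r invf_div (mulrC r) poweRrM.
have q0 : (0 < (p - 1)^-1)%R by rewrite invr_gt0.
move: (w y `^ _) (poweR_ge0 (w y) (p - 1)^-1) => [z| |//] z0.
  rewrite poweR_EFin !inver; rewrite lee_fin in z0.
  have [->|zn] := eqVneq z 0%R; first by rewrite powR0// eqxx poweRyr.
  rewrite powR_eq0 (negbTE zn)/=; congr (_%:E).
  by rewrite -!powR_inv1 ?powR_ge0// -!powRrM mulrC.
by rewrite poweRyr// invey poweR0r.
Qed.

Lemma weight_base_lty x n : \int[mu]_(y in (T x n : set (borel G))) w y < +oo.
Proof.
have [_ _ wK] := hw; have [K cK TK] := base_compact hU x n.
apply: le_lt_trans (wK K cK); apply: ge0_subset_integral => //.
- exact: measurable_base hU _ _.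
- exact: measurable_compact.
- exact: measurable_funTS.
Qed.

Lemma Ap_constant_ge0 s : 0 <= Ap_constant mu U s w.
Proof.
apply: (@le_trans _ _ (average mu w (T 0%R 0) *
    average mu (dual_weight s w) (T 0%R 0) `^ (s - 1))).
  by rewrite mule_ge0 ?poweR_ge0// average_ge0.
by apply: ereal_sup_ubound; exists (T 0%R 0) => //; exists 0%R, 0%R.
Qed.

(** Against [A0], this excludes the degenerate cases: [mu] vanishing on a base set, or [sigma] with
    infinite integral over one. *)
Lemma Ainfty_constant_eq0 (f : G -> \bar R) :
  (forall x n, (\int[mu]_(y in (T x n : set (borel G))) f y)^-1 *
    \int[mu]_(y in (T x n : set (borel G))) maximal mu U (f \_ (T x n)) y = 0) ->
  Ainfty_constant mu U f = 0.
Proof.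
move=> fV; apply/eqP; rewrite eq_le; apply/andP; split.
  by apply: ub_ereal_sup => _ [_ [x [n ->]] <-]; rewrite fV.
rewrite -(fV (0%R : G) (0%R : int)); apply: ereal_sup_ubound.
by exists (T 0%R 0) => //; exists 0%R, 0%R.
Qed.

Hypothesis A0 : fine (Ainfty_constant mu U sigma) != 0%R.

Lemma base_gt0 x n : 0 < mu (T x n).
Proof.
rewrite lt0e measure_ge0 andbT; apply: contra_neq A0 => /(null_base hU theta_lt) mu0.
have V0 y m : mu (T y m) = 0.
  apply/eqP; rewrite eq_le measure_ge0 andbT -mu0.
  by apply: le_measure; rewrite ?inE//; exact: measurable_base hU _ _.
rewrite (@Ainfty_constant_eq0 sigma)// => y m.
rewrite [X in _ * X](_ : _ = 0) ?mule0//.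
apply/eqP; rewrite eq_le integral_ge0 ?andbT; last by move=> z _; exact: maximal_ge0 hU _ _.
apply: (@le_trans _ _ (\int[mu]_(z in (T y m : set (borel G))) cst +oo z)).
  by apply: ge0_le_lower_integral => z _; rewrite ?leey//; exact: maximal_ge0 hU _ _.
by rewrite integral_cst; [rewrite V0 mule0|exact: measurable_base hU _ _].
Qed.

Hypothesis Ap_lty : Ap_constant mu U p w < +oo.

(** An infinite integral of [sigma] spreads to a base set containing any given [T y m]. There the
    finite A_p constant forces [w] to vanish almost everywhere, so [sigma] has infinite integral
    over [T y m] too. All A_infinity quotients are then 0, by [+oo^-1 = 0]. *)
Lemma dual_weight_base_lty x n : \int[mu]_(y in (T x n : set (borel G))) sigma y < +oo.
Proof.
have sge0 y m : 0 <= \int[mu]_(z in (T y m : set (borel G))) sigma z.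
  by apply: integral_ge0 => z _; exact: dual_weight_ge0.
rewrite ltey; apply: contra_neqN A0 => /eqP sxy.
rewrite (@Ainfty_constant_eq0 sigma)// => y m.
have [k kT] := base_absorb hU symU x y n m.
have mT z l : measurable (T z l : set (borel G)) by exact: measurable_base hU _ _.
have msT z l : measurable_fun (T z l : set (borel G)) (sigma : borel G -> \bar R).
  by apply: measurable_funTS; exact: measurable_dual_weight.
have sk : \int[mu]_(z in (T y k : set (borel G))) sigma z = +oo.
  apply/eqP; rewrite -leye_eq -sxy; apply: ge0_subset_integral => //.
  - by move=> z _; exact: dual_weight_ge0.
  - by move=> z xz; apply: kT; left.
have ik : 0 < (mu (T y k))^-1.
  by rewrite inve_gt0 ?base_gt0 ?(gt_eqF (base_gt0 y k)) ?(lt_eqF (base_lty hG mu_fin hU y k)).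
have wk : \int[mu]_(z in (T y k : set (borel G))) w z = 0.
  apply/eqP; rewrite eq_le integral_ge0 ?andbT// leNgt; apply/negP => wk.
  move: Ap_lty; rewrite ltNge => /negP; apply.
  apply: (@le_trans _ _ (average mu w (T y k) * average mu sigma (T y k) `^ (p - 1))).
    rewrite /average sk gt0_muley// poweRyr; last by rewrite subr_eq0 gt_eqF.
    by rewrite gt0_muley ?leey// mule_gt0.
  by apply: ereal_sup_ubound; exists (T y k) => //; exists y, k.
suff -> : \int[mu]_(z in (T y m : set (borel G))) sigma z = +oo by rewrite invey mul0e.
apply: (@integral_eq0_pinfty _ (borel G) _ mu _ w sigma) => //.
- exact: base_gt0.
- exact: measurable_dual_weight.
- by move=> z; exact: dual_weight_ge0.
- move=> z wz; rewrite /dual_weight wz conjugate_exponentB1// poweR0r ?inve0//.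
  by rewrite invr_eq0 subr_eq0 gt_eqF.
apply/eqP; rewrite eq_le integral_ge0 ?andbT// -wk.
apply: ge0_subset_integral => //; first exact: measurable_funTS.
by move=> z yz; apply: kT; right.
Qed.

(** Otherwise [w] would be infinite almost everywhere on a base set, against local integrability. *)
Lemma dual_weight_base_gt0 x n : 0 < \int[mu]_(y in (T x n : set (borel G))) sigma y.
Proof.
rewrite lt0e integral_ge0 ?andbT; last by move=> z _; exact: dual_weight_ge0.
apply/eqP => s0; have := weight_base_lty x n; rewrite ltNge => /negP; apply.
rewrite leye_eq; apply/eqP; apply: (@integral_eq0_pinfty _ (borel G) _ mu _ sigma w) => //.
- exact: measurable_base hU _ _.
- exact: base_gt0.
- exact: measurable_dual_weight.
- by move=> z; exact: dual_weight_ge0.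
- move=> y /eqP; rewrite inve_eq0 => /eqP; exact: poweR_eqy.
Qed.

Local Notation A := (fine (Ainfty_constant mu U sigma)).

Lemma maximal_dual_weight_le q :
  \int[mu]_(y in (V q : set (borel G))) maximal mu U (sigma \_ (V q)) y <=
  A%:E * \int[mu]_(y in (V q : set (borel G))) sigma y.
Proof.
(* [fine] sends infinite values to 0, so [A0] also says that the constant is finite. *)
have AE : Ainfty_constant mu U sigma = A%:E.
  by move: A0; case: (Ainfty_constant _ _ _) => //=; rewrite eqxx.
set I := \int[mu]_(y in _) sigma y.
have IE : I = (fine I)%:E.
  by rewrite fineK// ge0_fin_numE ?dual_weight_base_lty// ltW// dual_weight_base_gt0.
have I0 : (0 < fine I)%R by rewrite -lte_fin -IE dual_weight_base_gt0.
rewrite IE muleC -lee_pdivrMl//.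
have -> : (fine I)^-1%:E = I^-1 by rewrite IE inver gt_eqF.
by rewrite -AE; apply: ereal_sup_ubound; exists (V q) => //; exists q.1, q.2.
Qed.

(** On a base set the maximal function dominates the average over that set. *)
Lemma Ainfty_constant_ge1 : (1 <= A)%R.
Proof.
pose q : G * int := (0%R, 0%R).
have vE := base_averageE hG mu_fin hU base_gt0 (dual_weight_ge0 p) dual_weight_base_lty q.
have := maximal_dual_weight_le q; set I := \int[mu]_(y in _) sigma y => MI.
have IE : I = (fine I)%:E.
  by rewrite fineK// ge0_fin_numE ?dual_weight_base_lty// ltW// dual_weight_base_gt0.
have I0 : (0 < fine I)%R by rewrite -lte_fin -IE dual_weight_base_gt0.
rewrite -(ler_pM2r I0) mul1r -lee_fin EFinM -IE; apply: le_trans MI.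
rewrite /I vE -integral_cst; last exact: measurable_base hU _ _.
apply: ge0_le_lower_integral => y qy.
  by rewrite lee_fin base_average_ge0//; exact: dual_weight_ge0.
by apply: (base_average_le_maximal hG mu_fin hU base_gt0 (dual_weight_ge0 p) dual_weight_base_lty).
Qed.

Lemma average_base_le_theta (g : G -> \bar R) x i :
  measurable_fun setT (g : borel G -> \bar R) -> (forall y, 0 <= g y) ->
  average mu g (T x i) <= D%:E * average mu g (T x (theta i)).
Proof.
move=> mg g0; rewrite /average muleA; apply: lee_pmul => //.
- by rewrite inve_ge0.
- exact: integral_ge0.
- have fT n : mu (T x n) \is a fin_num by rewrite ge0_fin_numE// (base_lty hG mu_fin hU).
  have m0 n : (0 < fine (mu (T x n)))%R by rewrite fine_gt0// base_gt0 (base_lty hG mu_fin hU).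
  have := cf_doubling hU i x.
  rewrite -(fineK (fT i)) -(fineK (fT (theta i))) !inver !gt_eqF//.
  rewrite -EFinM !lee_fin => h.
  by rewrite ler_pdivlMr// ler_pdivrMl// mulrC.
- apply: ge0_subset_integral => //.
  + exact: measurable_base hU _ _.
  + exact: measurable_base hU _ _.
  + exact: measurable_funTS.
  + exact: (translate_theta hU).
Qed.

Let C_gt1 : (1 < 4 * D ^+ 10 * A)%R.
Proof.
have : (1 <= D ^+ 10)%R by rewrite exprn_ege1// (cf_doubling_ge1 hU).
have := Ainfty_constant_ge1; nra.
Qed.

Local Notation r := (4 * D ^+ 10 * A / (4 * D ^+ 10 * A - 1))%R.
Local Notation t0 x i := (base_average mu U sigma (x, theta i)).

(** Reverse Hoelder with e = 1/(c-1), so that r = 1 + e and e/(1+e) = 1/c; the smallness condition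
    then amounts to D^4 <= D^10. *)
Lemma average_dual_weight_powR_le x i :
  average mu (fun y => sigma y `^ r) (T x i) <= ((2 * D ^+ 4 * t0 x i) `^ r)%:E.
Proof.
have D1 := cf_doubling_ge1 hU; have D0 : (0 < D)%R := lt_le_trans ltr01 D1.
have A1 := Ainfty_constant_ge1; have A_gt0 : (0 < A)%R := lt_le_trans ltr01 A1.
have c1 := C_gt1; set c := (4 * D ^+ 10 * A)%R in c1 *.
have c0 : (0 < c)%R by rewrite (lt_trans ltr01).
pose e := ((c - 1)^-1)%R; have e0 : (0 < e)%R by rewrite invr_gt0 subr_gt0.
have cn : (c - 1 != 0)%R by rewrite subr_eq0 gt_eqF.
have re : (c / (c - 1) = 1 + e)%R by rewrite /e; field.
have ec : (e / (1 + e) = c^-1)%R by rewrite -re /e; field; rewrite cn gt_eqF.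
have he : (A * D ^+ 4 * (e / (1 + e)) <= 4^-1)%R.
  rewrite ec ler_pdivrMr// /c.
  rewrite (_ : (4^-1 * (4 * D ^+ 10 * A) = A * D ^+ 10)%R); last by field.
  by rewrite ler_wpM2l ?(ltW A_gt0)// ler_weXn2l.
have := reverse_holder hG mu_reg mu_fin hU symU theta_lt base_gt0 (measurable_dual_weight p)
  (dual_weight_ge0 p) dual_weight_base_lty A1 maximal_dual_weight_le x i e0 he.
rewrite -re; set t := t0 x i => H.
have t_ge0 : (0 <= t)%R by exact: base_average_ge0 (dual_weight_ge0 p) _.
have fT n : mu (T x n) \is a fin_num by rewrite ge0_fin_numE// (base_lty hG mu_fin hU).
have m0 : (0 < fine (mu (T x i)))%R by rewrite fine_gt0// base_gt0 (base_lty hG mu_fin hU).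
have dbl := cf_doubling hU i x.
set k := ((2 * D ^+ 2) `^ e * (2 * t `^ (c / (c - 1))))%R in H *.
have k0 : (0 <= k)%R by rewrite !mulr_ge0 ?powR_ge0.
(* The factor [D] comes from dividing by the measure of [T x i] rather than that of its dilate; 2 D
   (2 D^2)^e is then at most (2 D^4)^(1+e). *)
apply: (@le_trans _ _ (k * D)%:E).
  rewrite /average -(fineK (fT i)) inver gt_eqF// lee_pdivrMl//.
  apply: (le_trans H); rewrite (muleC (fine _)%:E) (EFinM k) -muleA fineK//.
  exact: lee_wpmul2l.
rewrite /k {H k k0}.
have D40 : (0 <= 2 * D ^+ 4)%R by rewrite mulr_ge0// exprn_ge0// ltW.
rewrite lee_fin re (powRM _ D40 t_ge0).
rewrite (_ : ((2 * D ^+ 4) `^ (1 + e) = (2 * D ^+ 4) * (2 * D ^+ 4) `^ e)%R); last first.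
  by rewrite -(@mulr_powRB1 _ _ (1 + e)%R)// ?addr_gt0// addrAC subrr add0r.
have h1 : ((2 * D ^+ 2) `^ e <= (2 * D ^+ 4) `^ e)%R.
  rewrite ge0_ler_powR ?nnegrE ?(ltW e0)// ?mulr_ge0 ?exprn_ge0 ?(ltW D0)//.
  by rewrite ler_wpM2l// ler_weXn2l.
have h2 : (2 * D <= 2 * D ^+ 4)%R by rewrite ler_wpM2l// -[leLHS]expr1 ler_weXn2l.
have -> : ((2 * D ^+ 2) `^ e * (2 * t `^ (1 + e)) * D =
  (2 * D) * (2 * D ^+ 2) `^ e * t `^ (1 + e))%R by ring.
apply: ler_wpM2r; first exact: powR_ge0.
by apply: ler_pM => //; rewrite ?powR_ge0// mulr_ge0// ltW.
Qed.

Lemma dual_exponentE : (p - (p - 1) / (4 * D ^+ 10 * A) = 1 + (p - 1) / r)%R.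
Proof.
have c1 := C_gt1; set c := (4 * D ^+ 10 * A)%R in c1 *.
have cn : (c - 1 != 0)%R by rewrite subr_eq0 gt_eqF.
by field; rewrite cn gt_eqF// (lt_trans ltr01).
Qed.

Let r_gt1 : (1 < r)%R.
Proof. by rewrite ltr_pdivlMr ?subr_gt0// mul1r gtrBl. Qed.

Lemma dual_exponent_gt1 : (1 < 1 + (p - 1) / r)%R.
Proof. by rewrite ltrDl divr_gt0 ?subr_gt0// (lt_trans ltr01). Qed.

(** The averages of [w] and of sigma^r over [T x i] are both compared with averages over the dilate
    [T x (theta i)], where the A_p condition for [p] applies. *)
Lemma Ap_constant_open :
  Ap_constant mu U (1 + (p - 1) / r) w <=
    (2 `^ (p - 1) * D `^ (4 * p - 2))%:E * Ap_constant mu U p w.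
Proof.
have D1 := cf_doubling_ge1 hU; have D0 : (0 < D)%R := lt_le_trans ltr01 D1.
have r0 : (0 < r)%R := lt_trans ltr01 r_gt1.
have p10 : (0 < p - 1)%R by rewrite subr_gt0.
apply: ub_ereal_sup => _ [_ [x [i ->]] <-].
rewrite [in X in _ `^ X]addrAC subrr add0r.
have -> : average mu (dual_weight (1 + (p - 1) / r) w) (T x i) =
    average mu (fun y => sigma y `^ r) (T x i).
  by congr (average mu _ _); apply/funext => y; exact: dual_weight_exponent.
set t := t0 x i; have t_ge0 : (0 <= t)%R by exact: base_average_ge0 (dual_weight_ge0 p) _.
have D40 : (0 <= 2 * D ^+ 4)%R by rewrite mulr_ge0// exprn_ge0// ltW.
have rp : (r * ((p - 1) / r) = p - 1)%R by rewrite mulrC divfK// gt_eqF.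
have pw : average mu (fun y => sigma y `^ r) (T x i) `^ ((p - 1) / r) <=
    ((2 * D ^+ 4) `^ (p - 1))%:E * (t `^ (p - 1))%:E.
  rewrite -EFinM -powRM//.
  have -> : ((2 * D ^+ 4 * t) `^ (p - 1))%:E = ((2 * D ^+ 4 * t) `^ r)%:E `^ ((p - 1) / r).
    by rewrite poweR_EFin -powRrM rp.
  have avg0 : 0 <= average mu (fun y => sigma y `^ r) (T x i).
    by apply: average_ge0 => y; exact: poweR_ge0.
  apply: gt0_ler_poweR.
  - exact: divr_ge0 (ltW p10) (ltW r0).
  - by rewrite in_itv/= avg0 leey.
  - by rewrite in_itv/= lee_fin powR_ge0 leey.
  - exact: average_dual_weight_powR_le.
apply: (@le_trans _ _ ((D%:E * average mu w (T x (theta i))) *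
    (((2 * D ^+ 4) `^ (p - 1))%:E * (t `^ (p - 1))%:E))).
  apply: lee_pmul => //; [exact: average_ge0|exact: poweR_ge0|].
  exact: average_base_le_theta.
rewrite muleACA -EFinM; apply: lee_pmul => //.
- by rewrite lee_fin mulr_ge0 ?powR_ge0// ltW.
- by rewrite mule_ge0 ?average_ge0// lee_fin powR_ge0.
(* The powers of [D] add up to 1 + 4(p-1) = 4p - 3, which is at most 4p - 2. *)
- rewrite lee_fin powRM ?exprn_ge0 ?(ltW D0)// mulrCA; apply: ler_wpM2l; first exact: powR_ge0.
  rewrite -powR_mulrn ?(ltW D0)// -powRrM -[X in (X * _)%R]powRr1 ?(ltW D0)//.
  rewrite -powRD; last by rewrite (gt_eqF D0) implybT.
  apply: ler_powR => //; lra.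
- have -> : (t `^ (p - 1))%:E = average mu sigma (T x (theta i)) `^ (p - 1).
    have := averageE hG mu_fin hU base_gt0 (dual_weight_ge0 p) dual_weight_base_lty.
    by move=> /(_ sigma (x, theta i)) ->.
  by apply: ereal_sup_ubound; exists (T x (theta i)) => //; exists x, (theta i).
Qed.

End Ap_weights.

Local Close Scope ereal_scope.

(* [htheta_lt] is not redundant: see the comment on [covering_family]. *)
Theorem lemma3p1 (R : realType) (G : topologicalZmodType)
  (hG : hausdorff_space G) (lcG : locally_compact [set: G])
  (mu : {measure set (borel G) -> \bar R})
  (mu_reg : inner_regular mu) (mu_fin : finite_on_compacts mu)
  (U : int -> set G) (D : R) (theta : int -> int)
  (hU : covering_family mu U D theta) (symU : symmetric_family U)
  (htheta_lt : forall i, i < theta i)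
  (p : R) (w : G -> \bar R) (hp : 1 < p) (hw : Ap mu U p w) :
  let sigma := dual_weight p w in
  let C := 4 * D ^+ 10 in
  let eps := (p - 1) / (C * fine (Ainfty_constant mu U sigma)) in
  Ap mu U (p - eps) w /\
  (Ap_constant mu U (p - eps) w <=
    (2 `^ (p - 1) * D `^ (4 * p - 2))%:E * Ap_constant mu U p w)%E.
Proof.
move=> sigma C eps; have [_ ww Apw] := hw.
(* A constant equal to 0 or [+oo] has [fine] value 0; then [eps] is 0 since [0^-1 = 0] in [R], and
   the factor in the bound is at least 1. *)
have [A0|A0] := eqVneq (fine (Ainfty_constant mu U sigma)) 0.
  rewrite /eps A0 mulr0 invr0 mulr0 subr0; split=> //.
  have powR_ge1 (a x : R) : 1 <= a -> 0 <= x -> 1 <= a `^ x.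
    by move=> a1 x0; rewrite -[leLHS](powRr0 a) ler_powR.
  apply: lee_pemull; first exact: Ap_constant_ge0.
  rewrite lee_fin -[leLHS]mulr1; apply: ler_pM => //; apply: powR_ge1; try lra.
  exact: cf_doubling_ge1 hU.
rewrite /eps /C (dual_exponentE hG mu_fin hU symU htheta_lt hp ww A0 Apw).
have open_le := Ap_constant_open hG mu_reg mu_fin hU symU htheta_lt hp ww A0 Apw.
split=> //; split=> //; first by
  exact: (dual_exponent_gt1 hG mu_fin hU symU htheta_lt hp ww A0 Apw).
by apply: le_lt_trans open_le _; rewrite lte_mul_pinfty// lee_fin mulr_ge0 ?powR_ge0.
Qed.
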